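(* Let $P$ be a UMEL-shellable poset and let $\mathrm{Tr}(P)$ be the truncation of $P$. Then $$\underline{\mathrm H}_{\mathrm{Tr}(P)}\preceq\underline{\mathrm H}_P,\quad \underline{\mathrm H}_{\mathrm{Tr}(P)}\preceq\mathrm H_{\mathrm{Tr}(P)},\quad \underline{\mathrm H}_P\preceq\mathrm H_P,\quad \mathrm H_{\mathrm{Tr}(P)}\preceq\mathrm H_P,$$ and likewise for the $\gamma$-polynomials: $$\gamma(\underline{\mathrm H}_{\mathrm{Tr}(P)};y)\preceq\gamma(\underline{\mathrm H}_P;y),\quad \gamma(\underline{\mathrm H}_{\mathrm{Tr}(P)};y)\preceq\gamma(\mathrm H_{\mathrm{Tr}(P)};y),\quad \gamma(\underline{\mathrm H}_P;y)\preceq\gamma(\mathrm H_P;y),\quad \gamma(\mathrm H_{\mathrm{Tr}(P)};y)\preceq\gamma(\mathrm H_P;y).$$ Equivalently, $$\underline{\mathrm H}_{\mathrm{Tr}(P)}\preceq\underline{\mathrm H}_P,\quad \underline{\mathrm H}_{\mathrm{Tr}(P)}\preceq\underline{\mathrm H}_{P^*},\quad \underline{\mathrm H}_P\preceq\mathrm H_{P^*},\quad \underline{\mathrm H}_{P^*}\preceq\mathrm H_{P^*},$$ and $$\gamma(\underline{\mathrm H}_{\mathrm{Tr}(P)};y)\preceq\gamma(\underline{\mathrm H}_P;y),\quad \gamma(\underline{\mathrm H}_{\mathrm{Tr}(P)};y)\preceq\gamma(\underline{\mathrm H}_{P^*};y),\quad \gamma(\underline{\mathrm H}_P;y)\preceq\gamma(\mathrm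 H_{P^*};y),\quad \gamma(\underline{\mathrm H}_{P^*};y)\preceq\gamma(\mathrm H_{P^*};y).$$
   Context: All posets are finite, bounded (minimum $\hat 0$, maximum $\hat 1$) and graded with rank function $\mathrm{rk}$, $\mathrm{rk}(\hat 0)=0$; the rank of $P$ is $\mathrm{rk}(\hat 1)$. Write $s\lessdot t$ if $t$ covers $s$, and $\mathcal E(P)$ for the set of covering pairs. $P^*$ is the dual (order-reversed) poset. If $P$ has rank $r\ge2$, the truncation $\mathrm{Tr}(P)$ is $P$ with all elements of rank $r-1$ removed (graded of rank $r-1$). UMEL-shellability. An edge labeling is a map $\lambda:\mathcal E(P)\to\Lambda$ to a totally ordered set $(\Lambda,\vartriangleleft)$. It is an EL-labeling if for all $s\le t$ there is a unique maximal chain $s=u_0\lessdot\cdots\lessdot u_k=t$ of $[s,t]$ with weakly increasing labels $\lambda(u_0,u_1)\trianglelefteq\cdots\trianglelefteq\lambda(u_{k-1},u_k)$, and its label sequence is lexicographically minimal among all maximal chains of $[s,t]$. An EL-labeled poset is a pair $(P,\lambda)$ with $\lambda$ an EL-labeling of $P$. For $s\in P$ let $\lambda_1\vartriangleleft\cdots\vartriangleleft\lambda_\ell$ be the distinct labels $\lambda(s,t)$, $t\gtrdot s$ (the labels above $s$). The width is $\omega_s(i)=|\{t: s\lessdot t,\ \lambda(s,t)=\lambda_i\}|$ (equal to $0$ for $i>\ell$). For $s\lessdot t$, $\mathrm{Ind}(s,t)$ is the $i$ with $\lambda(s,t)=\lambda_i$, and $\mathrm{des}_s(t)$ is the number of distinct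 labels above $t$ that are $\vartriangleleft\lambda(s,t)$. $(P,\lambda)$ is a rank-uniform labeled poset if (1) $\omega_s(i)=\omega_{s'}(i)$ for all $s,s'$ of the same rank and all $i\ge1$; and (2) $\mathrm{des}_s(t)=\mathrm{des}_{s'}(t')$ whenever $s\lessdot t$, $s'\lessdot t'$, $\mathrm{rk}(s)=\mathrm{rk}(s')$ and $\mathrm{Ind}(s,t)=\mathrm{Ind}(s',t')$. In that case $\mathrm{des}_k(i)$ denotes $\mathrm{des}_s(t)$ for any $s$ of rank $k$ and $t\gtrdot s$ with $\mathrm{Ind}(s,t)=i$, and $\ell_k$ is the number of distinct labels above any element of rank $k$. It is monotonic if for every $0\le k\le \mathrm{rk}(P)-1$ the function $i\mapsto\mathrm{des}_k(i)$ is weakly increasing on $\{1,\dots,\ell_k\}$. $P$ is UMEL-shellable if it admits an EL-labeling $\lambda$ such that $(P,\lambda)$ is a monotonic rank-uniform labeled poset. Chow polynomials. For $s<t$ let $\chi_{s,t}(x)=\sum_{w\in[s,t]}\mu(s,w)x^{\mathrm{rk}(t)-\mathrm{rk}(w)}$ ($\mu$ the Möbius function) and $\overline\chi_{s,t}(x)=\chi_{s,t}(x)/(x-1)$. The Chow polynomial is defined recursively by $\underline{\mathrm H}_P(x)=1$ if $|P|=1$ and $\underline{\mathrm H}_P(x)=\sum_{s\in P\setminus\{\hat 0\}}\overline\chi_{\hat 0,s}(x)\,\underline{\mathrm H}_{[s,\hat 1]}(x)$ otherwise. The augmented Chow polynomial is $\mathrm H_P(x)=\sum_{s\in P}x^{\mathrm{rk}(s)}\,\underline{\mathrm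 H}_{[s,\hat 1]}(x)$. $\gamma$-polynomials. If $f(x)=x^df(x^{-1})$ then $f(x)=\sum_{i=0}^{\lfloor d/2\rfloor}\gamma_i x^i(1+x)^{d-2i}$ for unique reals $\gamma_i$, and $\gamma(f;y)=\sum_i\gamma_iy^i$. For $P$ of rank $n\ge1$, $\underline{\mathrm H}_P$ is symmetric with $d=n-1$ and $\mathrm H_P$ is symmetric with $d=n$. Interlacing. For real-rooted $f$ of degree $n$ with roots $\alpha_n\le\cdots\le\alpha_1$ and real-rooted $g$ of degree $n$ or $n+1$ with roots $(\beta_{n+1}\le)\,\beta_n\le\cdots\le\beta_1$ (positive leading coefficients), $f\preceq g$ means $(\beta_{n+1}\le)\,\alpha_n\le\beta_n\le\alpha_{n-1}\le\cdots\le\alpha_1\le\beta_1$. By convention $0\preceq f$, $f\preceq 0$, $0\preceq 0$ for every real-rooted $f$. *)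

(* Defs.v *)
From HB Require Import structures.
From mathcomp Require Import all_boot all_order all_algebra.
From mathcomp Require Import reals.
From mathcomp Require classical_sets.
Set Implicit Arguments.
Unset Strict Implicit.
Unset Printing Implicit Defensive.
Import Order.TTheory GRing.Theory Num.Theory.

Section GradedPosets.
Local Open Scope order_scope.
Context {d : Order.disp_t} {T : finTBPOrderType d}.
Implicit Types (s t x y : T) (c : {set T}) (rho : T -> nat).

Definition covers s t : bool := (s < t) && [forall u, ~~ (s < u < t)].

Definition is_rank_function rho : Prop :=
  rho \bot = 0%N /\ (forall s t, covers s t -> rho t = (rho s).+1).

Definition is_chain c : bool := [forall x in c, forall y in c, x >=< y].

(* The length of a longest chain from \bot to x; lemma rankE shows that it is
   the rank function whenever there is one. *)
Definition rk x : nat :=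
  (\max_(c : {set T} | is_chain c && [forall y in c, (y < x)%O]) #|c|)%N.

End GradedPosets.

Definition graded {d : Order.disp_t} (T : finTBPOrderType d) : Prop :=
  exists rho : T -> nat, is_rank_function rho.

Definition rank {d : Order.disp_t} (T : finTBPOrderType d) : nat :=
  rk (\top%O : T).

Section RankTheory.
Local Open Scope order_scope.
Context {d : Order.disp_t} {T : finTBPOrderType d}.
Implicit Types (s t x y : T).

Lemma below_card s t : s < t -> (#|[set u | (u < s)%O]| < #|[set u | (u < t)%O]|)%N.
Proof.
move=> lt_st; apply/proper_card/properP; split.
  by apply/subsetP=> u; rewrite !inE => /lt_trans; apply.
by exists s; rewrite !inE ?ltxx.
Qed.

Lemma lt_covers s t : s < t -> exists2 u, s <= u & covers u t.
Proof.
move=> lt_st; pose P u := (s <= u) && (u < t).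
have Ps : P s by rewrite /P lexx.
case: (arg_maxnP (fun u : T => #|[set v | v < u]|) Ps) => u /andP[le_su lt_ut] u_max.
exists u => //; rewrite /covers lt_ut; apply/forallP=> v; apply/negP.
move=> /andP[lt_uv lt_vt].
have := u_max v; rewrite /P (le_trans le_su (ltW lt_uv)) lt_vt => /(_ isT) /=.
by rewrite leqNgt below_card.
Qed.

Lemma rank_function_mono (rho : T -> nat) : is_rank_function rho ->
  forall s t, s < t -> (rho s < rho t)%N.
Proof.
move=> [_ rhoS] s t; have [n] := ubnP #|[set u | u < t]|.
elim: n t => // n IHn t /ltnSE le_n lt_st.
have [u le_su cov_ut] := lt_covers lt_st; rewrite (rhoS _ _ cov_ut) ltnS.
move: le_su; rewrite le_eqVlt => /predU1P[-> // | lt_su].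
apply/ltnW/IHn => //; apply: leq_trans le_n; apply: below_card.
by case/andP: cov_ut.
Qed.

Lemma rankE (rho : T -> nat) : is_rank_function rho -> rk =1 rho.
Proof.
move=> rhoP x; have rho_mono := rank_function_mono rhoP.
have [rho0 rhoS] := rhoP; apply/eqP; rewrite eqn_leq; apply/andP; split.
  apply/bigmax_leqP=> c /andP[]; rewrite /is_chain => /forall_inP c_chain.
  move=> /forall_inP c_lt.
  have rho_inj : {in c &, injective rho}.
    move=> y z yc zc eq_yz; have /forall_inP/(_ z zc) := c_chain y yc.
    by case: comparableP => // /rho_mono; rewrite eq_yz ltnn.
  have sz : size [seq rho y | y in c] = #|c| by rewrite size_map cardE.
  rewrite -sz -(size_iota 0 (rho x)); apply: uniq_leq_size.
    rewrite map_inj_in_uniq ?enum_uniq // => y z.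
    by rewrite !mem_enum; apply: rho_inj.
  move=> k /mapP[y]; rewrite mem_enum => yc ->.
  by rewrite mem_iota /= add0n rho_mono // c_lt.
suff [c [c_chain c_lt <-]] : exists c : {set T},
    [/\ is_chain c, [forall y in c, y < x] & #|c| = rho x].
  by apply: (@bigop.bigmax_sup _ c) => //; rewrite c_chain.
have [n] := ubnP #|[set u | u < x]|.
elim: n x => // n IHn x /ltnSE le_n.
have [-> | x_neq0] := eqVneq x \bot.
  exists set0; rewrite cards0 rho0; split=> //.
    by apply/forall_inP=> y; rewrite inE.
  by apply/forall_inP=> y; rewrite inE.
have [u _ cov_ux] : exists2 u, \bot <= u & covers u x.
  by apply: lt_covers; rewrite lt0x.
have lt_ux : u < x by case/andP: cov_ux.
have [|c [/forall_inP c_chain /forall_inP c_lt c_card]] := IHn u.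
  exact: leq_trans (below_card lt_ux) le_n.
exists (u |: c)%SET; split.
- apply/forall_inP=> y /setU1P[-> | yc]; apply/forall_inP=> z /setU1P[-> | zc].
  + exact: comparablexx.
  + by rewrite comparable_sym; apply/lt_comparable/c_lt.
  + exact/lt_comparable/c_lt.
  + by have /forall_inP := c_chain y yc; apply.
- apply/forall_inP=> y /setU1P[-> // | yc].
  exact: lt_trans (c_lt y yc) lt_ux.
- rewrite cardsU1 c_card (rhoS _ _ cov_ux).
  by case: (boolP (u \in c)) => // /c_lt; rewrite ltxx.
Qed.

End RankTheory.

(* The elements of rank [rank T - 1] are removed.  Keeping \bot and \top
   explicitly only matters when [rank T < 2], where no truncation is defined;
   it makes the type below bounded unconditionally. *)
Definition truncP {d : Order.disp_t} {T : finTBPOrderType d} (x : T) : bool :=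
  [|| x == \bot%O, x == \top%O | rk x != (rank T).-1].

Record trunc {d : Order.disp_t} (T : finTBPOrderType d) :=
  Trunc { trunc_val : T; trunc_valP : truncP trunc_val }.

Section TruncInstances.
Context {d : Order.disp_t} {T : finTBPOrderType d}.

HB.instance Definition _ := [isSub for @trunc_val d T].
HB.instance Definition _ := [Finite of trunc T by <:].
HB.instance Definition _ := [SubChoice_isSubPOrder of trunc T by <: with d].

Fact trunc_bot_subproof : truncP (\bot%O : T).
Proof. by rewrite /truncP eqxx. Qed.
Fact trunc_top_subproof : truncP (\top%O : T).
Proof. by rewrite /truncP eqxx orbT. Qed.

Fact trunc_le0x (x : trunc T) : (Trunc trunc_bot_subproof <= x)%O.
Proof. exact: (le0x (trunc_val x)). Qed.
Fact trunc_lex1 (x : trunc T) : (x <= Trunc trunc_top_subproof)%O.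
Proof. exact: (lex1 (trunc_val x)). Qed.

HB.instance Definition _ := Order.hasBottom.Build d (trunc T) trunc_le0x.
HB.instance Definition _ := Order.hasTop.Build d (trunc T) trunc_lex1.

End TruncInstances.

(* An edge labeling is a function of two arguments of which only the values on
   covering pairs are ever used. *)
Section EdgeLabelings.
Local Open Scope order_scope.
Context {d : Order.disp_t} {T : finTBPOrderType d}.
Context {dL : Order.disp_t} {L : orderType dL}.
Variable lam : T -> T -> L.
Implicit Types (s t : T) (c : seq T).

(* The chain s = u_0 <. u_1 <. ... <. u_k = t is represented by its tail
   c = [:: u_1; ...; u_k]. *)
Definition maximal_chain s t c : bool := path covers s c && (last s c == t).

Definition chain_labels s c : seq L := pairmap lam s c.

Definition EL_labeling : Prop :=
  forall s t, s <= t ->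
  exists c, [/\ maximal_chain s t c,
                sorted <=%O (chain_labels s c),
                (forall c', maximal_chain s t c' ->
                   sorted <=%O (chain_labels s c') -> c' = c)
              & (forall c', maximal_chain s t c' ->
                   (chain_labels s c : seqlexi L) <= chain_labels s c')].

Definition labels_above s : seq L :=
  sort <=%O (undup [seq lam s t | t in [pred t | covers s t]]).

(* Indices start at 1. *)
Definition Ind s t : nat := (index (lam s t) (labels_above s)).+1.

Definition width s (i : nat) : nat := #|[set t | covers s t & Ind s t == i]|.

Definition des s t : nat := count (< lam s t) (labels_above t).

Definition rank_uniform : Prop :=
  (forall s s', rk s = rk s' -> forall i, (1 <= i)%N -> width s i = width s' i)
  /\ (forall s t s' t', covers s t -> covers s' t' -> rk s = rk s' ->
        Ind s t = Ind s' t' -> des s t = des s' t').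

(* The values des_k(i) and des_k(j), for i <= j, are represented by des s t and
   des s' t' for arbitrary s, s' of rank k. *)
Definition monotonic : Prop :=
  forall s t s' t', covers s t -> covers s' t' -> rk s = rk s' ->
    (Ind s t <= Ind s' t')%N -> (des s t <= des s' t')%N.

End EdgeLabelings.

Definition UMEL_shellable {d : Order.disp_t} (T : finTBPOrderType d) : Prop :=
  exists (dL : Order.disp_t) (L : orderType dL) (lam : T -> T -> L),
    [/\ EL_labeling lam, rank_uniform lam & monotonic lam].

Local Open Scope ring_scope.

Section Mobius.
Context {d : Order.disp_t} {T : finTBPOrderType d}.
Implicit Types s t u : T.

Fixpoint mobius_rec (n : nat) s t : int :=
  if n is m.+1 then
    if s == t then 1 else - \sum_(u | (s <= u < t)%O) mobius_rec m s u
  else 0.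

Definition mobius s t : int := mobius_rec #|T| s t.

Lemma mobius_recE n m s t :
    (#|[set u | (u < t)%O]| < n)%N -> (#|[set u | (u < t)%O]| < m)%N ->
  mobius_rec n s t = mobius_rec m s t.
Proof.
elim: n m t => // n IHn [|m] // t /ltnSE le_n /ltnSE le_m /=.
case: ifP => // _; congr (- _); apply: eq_bigr => u /andP[_ lt_ut].
by apply: IHn; [apply: leq_trans le_n | apply: leq_trans le_m];
   apply: below_card.
Qed.

Lemma below_card_max t : (#|[set u | (u < t)%O]| < #|T|)%N.
Proof.
rewrite -cardsT; apply/proper_card/properP; split; first exact/subsetT.
by exists t; rewrite !inE ?ltxx.
Qed.

Lemma mobiusE s t :
  mobius s t = if s == t then 1 else - \sum_(u | (s <= u < t)%O) mobius s u.
Proof.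
have -> : mobius s t = mobius_rec #|T|.+1 s t.
  by apply: mobius_recE => //; rewrite ?ltnS ?(ltnW (below_card_max _)) ?below_card_max.
by [].
Qed.

End Mobius.

Section ChowPolynomials.
Variable R : realType.
Context {d : Order.disp_t} {T : finTBPOrderType d}.
Implicit Types s t w : T.

Definition chi s t : {poly R} :=
  \sum_(w | (s <= w <= t)%O) (mobius s w)%:~R *: 'X^(rk t - rk w).

(* The division is exact for s < t. *)
Definition chi_bar s t : {poly R} := chi s t %/ ('X - 1).

Fixpoint chow_above_rec (n : nat) s : {poly R} :=
  if n is m.+1 then
    if s == \top%O then 1
    else \sum_(t | (s < t)%O) chi_bar s t * chow_above_rec m t
  else 0.

(* The Chow polynomial of the interval [s, \top]. *)
Definition chow_above s : {poly R} := chow_above_rec #|T| s.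

Lemma above_card s t :
  (s < t)%O -> (#|[set u | (t < u)%O]| < #|[set u | (s < u)%O]|)%N.
Proof.
move=> lt_st; apply/proper_card/properP; split.
  by apply/subsetP=> u; rewrite !inE; apply: lt_trans.
by exists t; rewrite !inE ?ltxx.
Qed.

Lemma above_card_max s : (#|[set u | (s < u)%O]| < #|T|)%N.
Proof.
rewrite -cardsT; apply/proper_card/properP; split; first exact/subsetT.
by exists s; rewrite !inE ?ltxx.
Qed.

Lemma chow_above_recE n m s :
    (#|[set u | (s < u)%O]| < n)%N -> (#|[set u | (s < u)%O]| < m)%N ->
  chow_above_rec n s = chow_above_rec m s.
Proof.
elim: n m s => // n IHn [|m] // s /ltnSE le_n /ltnSE le_m /=.
case: ifP => // _; apply: eq_bigr => u lt_su; congr (_ * _).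
by apply: IHn; [apply: leq_trans le_n | apply: leq_trans le_m];
   apply: above_card.
Qed.

Lemma chow_aboveE s :
  chow_above s = if s == \top%O then 1
                 else \sum_(t | (s < t)%O) chi_bar s t * chow_above t.
Proof.
have -> : chow_above s = chow_above_rec #|T|.+1 s.
  by apply: chow_above_recE => //; rewrite ?ltnS ?(ltnW (above_card_max _)) ?above_card_max.
by [].
Qed.

End ChowPolynomials.

Definition chow (R : realType) {d : Order.disp_t} (T : finTBPOrderType d) :
  {poly R} := chow_above R (\bot%O : T).

Definition aug_chow (R : realType) {d : Order.disp_t} (T : finTBPOrderType d) :
  {poly R} := \sum_(s : T) 'X^(rk s) * chow_above R s.

Section GammaPolynomials.
Variable R : realType.
Implicit Types f g : {poly R}.

Definition gamma_expansion (n : nat) f g : Prop :=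
  (size g <= n./2.+1)%N /\
  f = \sum_(i < n./2.+1) g`_i *: ('X^i * (1 + 'X) ^+ (n - 2 * i)).

(* The gamma-polynomial of f with respect to the degree n.  It is meaningful if
   f is symmetric: see gamma_expansionP and gammaP. *)
Definition gamma (n : nat) f : {poly R} := classical_sets.xget 0 (gamma_expansion n f).

Lemma gamma_basis_free (e : nat -> nat) (m : nat) (a : nat -> R) :
  \sum_(i < m) a i *: ('X^i * (1 + 'X) ^+ e i) = 0 :> {poly R} ->
  forall i, (i < m)%N -> a i = 0.
Proof.
elim: m e a => // m IHm e a; rewrite big_ord_recl /= expr0 mul1r => sum0.
pose S : {poly R} :=
  \sum_(i < m) a i.+1 *: ('X^i * (1 + 'X) ^+ e i.+1).
have SE : \sum_(i < m) a (bump 0 i) *: ('X^(bump 0 i) * (1 + 'X) ^+ e (bump 0 i))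
          = 'X * S.
  rewrite mulr_sumr; apply: eq_bigr => i _.
  by rewrite /bump add1n exprS -mulrA scalerAr.
rewrite SE in sum0.
have a0 : a 0%N = 0.
  move/(congr1 (horner^~ 0)): sum0.
  rewrite hornerD hornerM hornerX mul0r addr0 hornerZ horner_exp hornerD.
  by rewrite hornerX hornerC addr0 expr1n mulr1 horner0.
move: sum0; rewrite a0 scale0r add0r => /eqP; rewrite mulf_eq0 polyX_eq0 /=.
move=> /eqP/(IHm (e \o succn) (a \o succn)) IH [|i] // lt_im.
exact: IH.
Qed.

Lemma gamma_expansion_unique n f g h :
  gamma_expansion n f g -> gamma_expansion n f h -> g = h.
Proof.
move=> [sz_g ->] [sz_h /eqP]; rewrite -subr_eq0 -sumrB => /eqP sum0.
apply/polyP=> i; case: (ltnP i n./2.+1) => [lt_i | le_i].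
  apply/eqP; rewrite -subr_eq0; apply/eqP.
  pose a j := g`_j - h`_j; rewrite -/(a i).
  apply: (@gamma_basis_free (fun j => n - 2 * j)%N n./2.+1 a) => //.
  by rewrite -[RHS]sum0; apply: eq_bigr => j _; rewrite scalerBl.
by rewrite !nth_default // ?(leq_trans sz_g) ?(leq_trans sz_h).
Qed.

Lemma coef_1X n i : ((1 + 'X) ^+ n : {poly R})`_i = 'C(n, i)%:R.
Proof.
rewrite exprDn coef_sum.
under eq_bigr => j _ do rewrite expr1n mul1r coefMn coefXn.
case: (ltnP i n.+1) => [lt_i | lt_n].
  rewrite (bigD1 (Ordinal lt_i)) //= eqxx big1 ?addr0 // => j ne_j.
  by rewrite (_ : i == j = false) ?mul0rn //; apply: contra_neqF ne_j => /eqP ij; apply: val_inj.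
rewrite bin_small // big1 // => j _.
by rewrite (_ : i == j = false) ?mul0rn //; apply/eqP => ij; rewrite ij ltnNge -ltnS ltn_ord in lt_n.
Qed.

Lemma gamma_expansionP n f : (size f <= n.+1)%N ->
  (forall i, (i <= n)%N -> f`_i = f`_(n - i)) ->
  exists g, gamma_expansion n f g.
Proof.
have [m] := ubnP n; elim: m n f => // m IHm n f /ltnSE le_nm sz_f sym_f.
pose f1 := f - f`_0 *: (1 + 'X) ^+ n.
have f1E i : f1`_i = f`_i - f`_0 * 'C(n, i)%:R.
  by rewrite coefB coefZ coef_1X.
have f1_sym i : (i <= n)%N -> f1`_i = f1`_(n - i).
  by move=> le_in; rewrite !f1E sym_f // bin_sub.
have f1_0 : f1`_0 = 0 by rewrite f1E bin0 mulr1 subrr.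
have f1_n i : (n <= i)%N -> f1`_i = 0.
  rewrite leq_eqVlt => /predU1P[<- | lt_ni]; first by rewrite f1_sym // subnn.
  by rewrite f1E bin_small // mulr0 subr0 nth_default // (leq_trans sz_f).
have fE : f = f`_0 *: (1 + 'X) ^+ n + f1 by rewrite addrC subrK.
case: n => [|[|n]] in le_nm sz_f sym_f f1 f1E f1_sym f1_0 f1_n fE *.
- exists (f`_0)%:P; split; first exact: size_polyC_leq1.
  rewrite big_ord1 coefC expr0 mul1r [LHS]fE.
  by rewrite (_ : f1 = 0) ?addr0 //; apply/polyP => i; rewrite coef0 f1_n.
- exists (f`_0)%:P; split; first exact: size_polyC_leq1.
  rewrite big_ord1 coefC expr0 mul1r [LHS]fE.
  rewrite (_ : f1 = 0) ?addr0 //; apply/polyP => -[|i]; rewrite coef0 //.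
  by rewrite f1_n.
have f1X : f1 = 'X * (f1 %/ 'X).
  rewrite mulrC divpK // -['X]subr0 -[X in 'X - X]/(0%:P) dvdp_XsubCl.
  by rewrite rootE horner_coef0 f1_0.
set f2 := f1 %/ 'X in f1X.
have f2E i : f2`_i = f1`_i.+1 by rewrite f1X coefXM.
have [|||g [sz_g gE]] := IHm n f2.
- exact: ltnW.
- apply/leq_sizeP => i lt_ni; rewrite f2E f1_n //.
- move=> i le_in; rewrite !f2E f1_sym ?subSS ?subSn //; exact: leqW.
exists ((f`_0)%:P + 'X * g); split.
  apply: leq_trans (size_polyD _ _) _; rewrite geq_max.
  rewrite (leq_trans (size_polyC_leq1 _)) //=.
  apply: leq_trans (size_polyMleq _ _) _; rewrite size_polyX addSn /= add1n.
  by rewrite ltnS.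
rewrite [LHS]fE big_ord_recl coefD coefC coefXM /= addr0 expr0 mul1r.
congr (_ + _); rewrite f1X gE mulr_sumr; apply: eq_bigr => i _.
rewrite coefD coefC coefXM /bump add1n /= add0r exprS -mulrA mulnS.
by rewrite -!scalerAr.
Qed.

Lemma gammaP n f g : gamma_expansion n f g -> gamma n f = g.
Proof.
move=> fg; rewrite /gamma; case: classical_sets.xgetP => [h _ fh | /(_ g) //].
exact: gamma_expansion_unique fh fg.
Qed.

End GammaPolynomials.

(* For a poset of rank n the Chow polynomial is symmetric with respect to n - 1
   and the augmented Chow polynomial with respect to n. *)
Definition gamma_chow (R : realType) {d : Order.disp_t}
    (T : finTBPOrderType d) : {poly R} := gamma (rank T).-1 (chow R T).

Definition gamma_aug_chow (R : realType) {d : Order.disp_t}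
    (T : finTBPOrderType d) : {poly R} := gamma (rank T) (aug_chow R T).

Section Interlacing.
Variable R : realType.
Implicit Types (f g : {poly R}) (a b : seq R).

(* The roots of f with multiplicities, in weakly decreasing order. *)
Definition ordered_roots f a : Prop :=
  sorted >=%R a /\ f = lead_coef f *: \prod_(z <- a) ('X - z%:P).

Definition real_rooted f : Prop := exists a, ordered_roots f a.

Definition interlaces f g : Prop :=
  [/\ real_rooted f, real_rooted g &
   f <> 0 -> g <> 0 ->
   [/\ 0 < lead_coef f, 0 < lead_coef g &
    exists a b,
      [/\ ordered_roots f a, ordered_roots g b,
          size b = size a \/ size b = (size a).+1,
          (forall i, (i < size a)%N -> a`_i <= b`_i)
        & (forall i, (i < size a)%N -> (i.+1 < size b)%N -> b`_i.+1 <= a`_i)]]].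

End Interlacing.

Notation "f ≼ g" := (interlaces f g) (at level 70, no associativity).

(* Main.v *)
Require Import Defs.
From mathcomp Require Import all_boot all_order all_algebra.
From mathcomp Require Import reals.
From mathcomp Require boolp.
From mathcomp Require Import zify ring lra.
Set Implicit Arguments.
Unset Strict Implicit.
Unset Printing Implicit Defensive.
Import Order.TTheory GRing.Theory Num.Theory.

(** Chow polynomials only depend on the flag numbers, the numbers of chains with
    prescribed ranks.  Suppose that, for a graded poset of rank n, the number of
    chains with rank set T is the sum of beta(S) over S contained in T.  Then the
    gamma-polynomial of the augmented Chow polynomial is the sum of
    beta(S) y^|S| over the subsets S of {1, ..., n-1} without consecutive
    elements, and that of the Chow polynomial is the same sum restricted to
    1 not in S ([chow_gamma_expansion]).  Truncating the poset forbids n-1 in S,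
    and passing to the dual poset replaces S by n - S.  Hence the Chow polynomial
    of the dual poset is the augmented Chow polynomial of the truncation, the
    augmented Chow polynomials of a poset and its dual agree, and the relations
    that involve the dual poset are instances of the others.

    For an EL-labeled poset, beta(S) is the number of maximal chains with descent
    set S ([flag_count_descents]): a chain extends to a maximal one that increases
    between its elements in a unique way.  If the labeling is rank-uniform, the
    descents of a chain are determined by the indices of its labels, so beta(S)
    is a weighted number of sequences of indices, where a pair of consecutive
    indices (i, j) at rank k is a descent if j <= des_k(i)
    ([descent_count_paths]).  Monotonicity says that these pairs form a staircase.

    The gamma-polynomials thus satisfy a transfer recursion.  For the sequences
    starting with a given index i, let B_i be the sum over those whose first pair
    is not a descent, counted in y, and y C_i the sum over those whose first pair
    is one.  The recursion replaces B_i by the sum of B_j + y C_j over the j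
    outside row i of the staircase, and C_i by the sum of the B_j over the j in
    row i.  It preserves the property that the sequence of all C_i followed by
    all B_i is interlacing and that the B_i + y C_i form an interlacing sequence
    ([transfer_invariant_step]).  This rests on two facts: the polynomials
    interlacing a given one form a convex cone ([precDr]), and multiplication by
    y exchanges the two sides of the relation ([prec_mulX]).  The invariant gives
    sum B_i ⪯ sum (B_i + y C_i), that is, forbidding a descent at the first rank
    yields a polynomial that interlaces the original one.  The staircase
    condition is symmetric, so the paths can also be read backwards, and the same
    holds for the last rank, that is, for the truncation ([prec_stable_sums]).

    Finally, f(x) = (1+x)^d g(x/(1+x)^2) if g is the gamma-polynomial of f.  Each
    root r < 0 of g yields two roots of f, one in ]-1, 0[, increasing with r, and
    its inverse, and the remaining roots of f are -1.  Therefore interlacing of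
    the gamma-polynomials implies interlacing of the polynomials when the degrees
    d of symmetry are consecutive ([prec_interlaces]), as they are in all cases. *)

Local Open Scope ring_scope.

(** * Interlacing root lists *)

Section InterlacedRoots.
Variable R : rcfType.
Implicit Types (a b : seq R) (f g h p : {poly R}) (x z : R).

Definition prodX a : {poly R} := \prod_(x <- a) ('X - x%:P).

(** Comparing the numbers of entries above each threshold expresses interlacing
    of the multisets of roots without sorting them, so that common roots can be
    cancelled.  The strict and the weak counts together determine the
    multiplicity of a given root. *)
Definition interlaced a b : Prop := forall z,
  (count (> z) a <= count (> z) b <= (count (> z) a).+1)%N /\
  (count (>= z) a <= count (>= z) b <= (count (>= z) a).+1)%N.

Lemma interlaced_refl a : interlaced a a.
Proof. by move=> z; split; rewrite leqnn leqnSn. Qed.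

Lemma interlaced_perm a a' b b' : perm_eq a a' -> perm_eq b b' ->
  interlaced a b -> interlaced a' b'.
Proof. by move=> /permP pa /permP pb ab z; rewrite -!pa -!pb. Qed.

Lemma interlaced_cons x a b : interlaced (x :: a) (x :: b) <-> interlaced a b.
Proof. by split=> ab z; have /= [] := ab z; split; lia. Qed.

Lemma count_ge z a : count (>= z) a = (count_mem z a + count (> z) a)%N.
Proof.
by elim: a => //= y a ->; case: (ltgtP z y) => //=; lia.
Qed.

Lemma interlaced_size a b : interlaced a b -> (size a <= size b <= (size a).+1)%N.
Proof.
pose z := - \sum_(x <- a ++ b) `|x| - 1; move=> /(_ z)[+ _].
have lt_z x : x \in a ++ b -> z < x.
  move=> abx; rewrite /z (big_rem x) //=.
  have ge0 : 0 <= \sum_(y <- rem x (a ++ b)) `|y| by apply: sumr_ge0.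
  have := ler_norm (- x); rewrite normrN; lra.
have : all (> z) a.
  by apply/allP => x ax; apply: lt_z; rewrite mem_cat ax.
rewrite all_count => /eqP ->; have : all (> z) b; last by rewrite all_count => /eqP ->.
by apply/allP => x bx; apply: lt_z; rewrite mem_cat bx orbT.
Qed.

Lemma prodX_sign z b :
  (prodX b).[z] = (-1) ^+ count (> z) b * `|(prodX b).[z]|.
Proof.
rewrite /prodX; elim: b => [|y b IHb] /=.
  by rewrite big_nil hornerC normr1 mulr1.
rewrite big_cons hornerM normrM hornerXsubC {1}IHb exprD.
case: ltP => /= [lt_zy | le_yz].
  by rewrite (ltr0_norm (_ : z - y < 0)) ?subr_lt0 // expr1; ring.
by rewrite (ger0_norm (_ : 0 <= z - y)) ?subr_ge0 // expr0; ring.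
Qed.

Lemma prodX_eq0 z b : ((prodX b).[z] == 0) = (z \in b).
Proof. by rewrite -rootE root_prod_XsubC. Qed.

Lemma prodX_cons x a : prodX (x :: a) = ('X - x%:P) * prodX a.
Proof. by rewrite /prodX big_cons. Qed.

Lemma prodX_perm a b : perm_eq a b -> prodX a = prodX b.
Proof. by move=> ab; apply: perm_big. Qed.

Lemma lead_coef_prodX c a : lead_coef (c *: prodX a) = c.
Proof. by rewrite lead_coefZ (monicP (monic_prod_XsubC _ _ _)) mulr1. Qed.

Lemma size_scale_prodX c a : c != 0 -> size (c *: prodX a) = (size a).+1.
Proof. by move=> c0; rewrite size_scale // size_prod_XsubC. Qed.

(** The intermediate value theorem yields one root in each gap between
    consecutive points. *)
Lemma alternating_roots p x a : path >%R x a ->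
    (forall i, (i <= size a)%N -> 0 < (-1) ^+ i * p.[nth x (x :: a) i]) ->
  exists b, [/\ size b = size a, all (root p) b, path >%R x b,
                all (> last x a) b & interlaced a b].
Proof.
elim: a x p => [|y a IHa] x p; first by exists [::].
move=> /= /andP[lt_yx lt_a] alt.
have [i le_ia|b [szb rb lt_b gt_b ab]] := IHa y (- p) lt_a.
  have := alt i.+1 le_ia; rewrite exprS hornerN /=.
  rewrite (set_nth_default y x) ?ltnS //; lra.
have px : 0 < p.[x] by have := alt 0 isT; rewrite mul1r.
have py : p.[y] < 0 by have := alt 1 isT; rewrite /= expr1 mulN1r oppr_gt0.
have [z /andP[le_yz le_zx] rz] : exists2 z, y <= z <= x & root p z.
  by apply: poly_ivt; rewrite ?ltW.
have lt_yz : y < z.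
  by rewrite lt_neqAle le_yz andbT; apply: contraTneq rz => <-; rewrite rootE lt_eqF.
have lt_zx : z < x.
  by rewrite lt_neqAle le_zx andbT; apply: contraTneq rz => ->; rewrite rootE gt_eqF.
have ltb : all (< y) b := order_path_min (rev_trans lt_trans) lt_b.
have lta : all (< y) a := order_path_min (rev_trans lt_trans) lt_a.
have le_last : last y a <= y.
  have : last y a \in y :: a by rewrite mem_last.
  by rewrite inE => /predU1P[-> // | /(allP lta) /ltW].
have none c w : all (< y) c -> y <= w -> count (> w) c = 0%N.
  move=> /allP ltc le_yw; apply/eqP; rewrite -leqn0 leqNgt -has_count.
  by apply/hasP => -[t /ltc /= lt_ty lt_wt];
    have := lt_trans lt_ty (le_lt_trans le_yw lt_wt); rewrite ltxx.
have noneq c w : all (< y) c -> y <= w -> count (>= w) c = 0%N.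
  move=> ltc le_yw; rewrite count_ge none // addn0.
  by apply/count_memPn/negP => /(allP ltc) /=; rewrite ltNge le_yw.
exists (z :: b); split=> /=.
- by rewrite szb.
- by rewrite rz; apply: sub_all rb => t; rewrite rootN.
- rewrite lt_zx; case: b lt_b {szb rb gt_b ab ltb} => //= t b /andP[lt_ty ->].
  by rewrite andbT (lt_trans lt_ty).
- by rewrite (le_lt_trans le_last).
move=> w; have [ab1 ab2] := ab w; split; rewrite /=.
  case: (ltP w y) => [lt_wy|le_yw]; last by rewrite !none //; case: ltP.
  by rewrite (lt_trans lt_wy lt_yz).
case: (leP w y) => [le_wy|/ltW le_yw]; last by rewrite !noneq //; case: leP.
by rewrite (le_trans le_wy le_yz).
Qed.

Lemma count_gt_nth a i : sorted >%R a -> (i < size a)%N ->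
  count (> a`_i) a = i.
Proof.
elim: a i => //= y a IHa i lt_a.
have lta : all (< y) a := order_path_min (rev_trans lt_trans) lt_a.
case: i => [|i] /= lt_i.
  rewrite ltxx; apply/eqP; rewrite -leqn0 leqNgt -has_count.
  by apply/hasP => -[t /(allP lta) /= lt_ty /(lt_trans lt_ty)]; rewrite ltxx.
rewrite IHa ?(path_sorted lt_a) //.
by have /= := allP lta _ (mem_nth 0 lt_i); rewrite ltNge; case: ltP.
Qed.

Lemma exists_upper_bound a : exists x, all (< x) a.
Proof.
exists (1 + \sum_(x <- a) `|x|); apply/allP => x ax /=; rewrite (big_rem x) //=.
have ge0 : 0 <= \sum_(y <- rem x a) `|y| by apply: sumr_ge0.
have := ler_norm x; lra.
Qed.

Lemma prodX_gt0 x b : all (< x) b -> 0 < (prodX b).[x].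
Proof.
elim: b => [|y b IHb] /=; first by rewrite /prodX big_nil hornerC.
by move=> /andP[lt_yx /IHb]; rewrite prodX_cons hornerM hornerXsubC => pos;
  rewrite mulr_gt0 ?subr_gt0.
Qed.

(** Roots common to all three lists can be cancelled.  After that the roots in
    [a] are simple, and at each of them the two summands have the same weak sign
    and do not both vanish; hence the sum changes sign from each root in [a] to
    the next one. *)
Lemma interlaced_sum a b1 b2 (e1 e2 : R) : 0 < e1 -> 0 < e2 ->
  interlaced a b1 -> interlaced a b2 ->
  exists e b, [/\ 0 < e, e1 *: prodX b1 + e2 *: prodX b2 = e *: prodX b
                & interlaced a b].
Proof.
move=> e1_gt0 e2_gt0; have [n] := ubnP (size a).
elim: n a b1 b2 => // n IHn a b1 b2 /ltnSE le_an ab1 ab2.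
have [/hasP[r ar /andP[b1r b2r]] | common] :=
    boolP (has (fun r => (r \in b1) && (r \in b2)) a).
  have pa := perm_to_rem ar; have pb1 := perm_to_rem b1r.
  have pb2 := perm_to_rem b2r.
  have ab1' : interlaced (rem r a) (rem r b1).
    by apply/(interlaced_cons r); apply: interlaced_perm ab1.
  have ab2' : interlaced (rem r a) (rem r b2).
    by apply/(interlaced_cons r); apply: interlaced_perm ab2.
  have [|e [b [e_gt0 sum_b ab]]] := IHn _ _ _ _ ab1' ab2'.
    by apply: leq_trans le_an; rewrite (perm_size pa).
  exists e, (r :: b); split=> //.
    rewrite (prodX_perm pb1) (prodX_perm pb2) !prodX_cons.
    by rewrite !scalerAr -mulrDr sum_b.
  apply: (interlaced_perm _ (perm_refl _)) (iffRL (interlaced_cons r _ _) ab).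
  by rewrite perm_sym.
pose G := e1 *: prodX b1 + e2 *: prodX b2; rewrite -/G.
wlog sorted_a : a le_an ab1 ab2 common / sorted >=%R a.
  move=> wlog_a; have pa : perm_eq a (sort >=%R a) by rewrite perm_sym perm_sort.
  have [|||||e [b [e_gt0 sum_b ab]]] := wlog_a (sort >=%R a).
  - by rewrite size_sort.
  - exact: interlaced_perm ab1.
  - exact: interlaced_perm ab2.
  - by rewrite -(perm_has _ pa).
  - by apply: sort_sorted => x y; apply: le_total.
  by exists e, b; split=> //; apply: interlaced_perm ab; rewrite // perm_sym.
have not_common r : r \in a -> r \in b1 -> r \in b2 -> False.
  by move=> ar b1r b2r; case/hasP: common; exists r => //; rewrite b1r.
(* A repeated entry of a is an entry of both b1 and b2. *)
have uniq_a : uniq a.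
  apply: count_mem_uniq => r; case: (boolP (r \in a)) => [ar | /count_memPn //].
  apply/eqP; rewrite eqn_leq -has_count has_pred1 ar andbT leqNgt; apply/negP => cnt.
  have := ab1 r; have := ab2 r; rewrite !count_ge => -[h1 h2] [h3 h4].
  by apply: (not_common r ar); rewrite -has_pred1 has_count; lia.
have lt_a : sorted >%R a.
  suff: sorted <%R (rev a) by rewrite rev_sorted.
  by rewrite lt_sorted_uniq_le rev_uniq uniq_a rev_sorted.
have simple i b : (i < size a)%N -> interlaced a b -> a`_i \notin b ->
    count (> a`_i) b = i.+1.
  move=> lt_i ab /count_memPn bi; have := ab (a`_i).
  rewrite !count_ge bi count_gt_nth // count_uniq_mem // mem_nth //.
  by move=> -[/andP[_ h1] /andP[h2 _]]; apply/eqP; rewrite eqn_leq h1; exact: h2.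
have sign_b i b : (i < size a)%N -> interlaced a b ->
    0 <= (-1) ^+ i.+1 * (prodX b).[a`_i] ?= iff (a`_i \in b).
  move=> lt_i ab; case: (boolP (a`_i \in b)) => bi.
    by move: (bi); rewrite -prodX_eq0 => /eqP ->; rewrite mulr0; apply/leifP.
  rewrite prodX_sign simple // mulrA -expr2 sqrr_sign mul1r.
  by apply/leifP; rewrite normr_gt0 prodX_eq0.
have alt i : (i < size a)%N -> 0 < (-1) ^+ i.+1 * G.[a`_i].
  move=> lt_i; rewrite hornerD !hornerZ mulrDr !(mulrCA _ e1) !(mulrCA _ e2).
  have [le1 eq1] := sign_b i b1 lt_i ab1; have [le2 eq2] := sign_b i b2 lt_i ab2.
  have [b1i | b1i] := boolP (a`_i \in b1).
    apply: ltr_wpDl; first by rewrite mulr_ge0 // ltW.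
    rewrite mulr_gt0 // lt_neqAle eq2 le2 andbT; apply/negP.
    exact: not_common (mem_nth 0 lt_i) b1i.
  apply: ltr_pwDl; last by rewrite mulr_ge0 // ltW.
  by rewrite mulr_gt0 // lt_neqAle eq1 le1 andbT.
have [x0 gt_x0] := exists_upper_bound (a ++ b1 ++ b2).
have {gt_x0} [gt_a gt_b1 gt_b2] : [/\ all (< x0) a, all (< x0) b1 & all (< x0) b2].
  by move: gt_x0; rewrite !all_cat => /and3P[].
have path_a : path >%R x0 a by case: (a) gt_a lt_a => //= y t /andP[->].
have [|b [sz_b root_b path_b last_b ab]] := @alternating_roots G x0 a path_a.
  case=> [_|i lt_i] /=; last by rewrite (set_nth_default 0) // alt.
  by rewrite mul1r hornerD !hornerZ addr_gt0 ?mulr_gt0 ?prodX_gt0.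
have uniq_b : uniq_roots b.
  rewrite uniq_rootsE.
  apply: (@sorted_uniq _ >%R); first exact: rev_trans lt_trans.
    by move=> x; rewrite /= ltxx.
  exact: path_sorted path_b.
have szZ e' b' : 0 < e' -> size (e' *: prodX b') = (size b').+1.
  by move=> e'_gt0; rewrite size_scale_prodX ?gt_eqF.
have lcZ e' b' : 0 < e' -> (e' *: prodX b')`_(size b') = e'.
  by move=> e'_gt0; rewrite -[RHS](lead_coef_prodX e' b') lead_coefE szZ.
have lcG : 0 < lead_coef G /\ size G = (maxn (size b1) (size b2)).+1.
  rewrite /G; case: (ssrnat.ltngtP (size b1) (size b2)) => sz.
  - by rewrite lead_coefDr ?szZ // lead_coef_prodX addrC size_polyDl ?szZ.
  - by rewrite lead_coefDl ?szZ // lead_coef_prodX size_polyDl ?szZ.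
  have e_gt0 : 0 < e1 + e2 by apply: addr_gt0.
  have G_lc : G`_(size b1) = e1 + e2.
    by rewrite coefD lcZ // sz lcZ.
  have szG : size G = (size b2).+1.
    apply/eqP; rewrite eqn_leq (leq_trans (size_polyD _ _)) ?szZ // ?sz ?maxnn //=.
    by rewrite ltnNge; apply/negP => /leq_sizeP/(_ _ (leqnn _));
      rewrite -sz G_lc => e0; rewrite e0 ltxx in e_gt0.
  by split; rewrite -?/G ?lead_coefE szG /= -sz ?G_lc.
case: lcG => lcG szG.
have [le_a1 le_1a] := andP (interlaced_size ab1).
have [le_a2 le_2a] := andP (interlaced_size ab2).
have [szGa | szGa] : size G = (size a).+1 \/ size G = (size a).+2.
  by move: szG le_a1 le_1a le_a2 le_2a; clear; lia.
  exists (lead_coef G), b; split=> //.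
  by rewrite {1}(all_roots_prod_XsubC _ root_b uniq_b) // szGa sz_b.
have [q Gq] := uniq_roots_prod_XsubC root_b uniq_b.
have G_neq0 : G != 0 by rewrite -size_poly_eq0 szGa.
have q_neq0 : q != 0 by apply: contraNneq G_neq0 => q0; rewrite Gq q0 mul0r.
have lcq : lead_coef q = lead_coef G.
  by rewrite Gq lead_coefM (monicP (monic_prod_XsubC _ _ _)) mulr1.
have szq : size q = 2%N.
  have := congr1 (fun p : {poly R} => size p) Gq.
  by rewrite size_Mmonic ?monic_prod_XsubC // size_prod_XsubC szGa sz_b addnS /=
     -addn2 addnC => /addIn <-.
pose y := - q`_0 / lead_coef q.
have qE : q = lead_coef q *: ('X - y%:P).
  apply/polyP => -[|[|i]]; rewrite coefZ coefB coefX coefC /=.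
  - by rewrite sub0r /y mulNr opprK mulrCA mulfV ?mulr1 ?lead_coef_eq0.
  - by rewrite subr0 mulr1 lead_coefE szq.
  by rewrite subr0 mulr0 nth_default // szq.
exists (lead_coef G), (y :: b); split=> //.
  by rewrite {1}Gq prodX_cons {1}qE lcq scalerAl.
case: (posnP (size a)) => [/size0nil a0 | a_gt0].
  by move: sz_b; rewrite a0 => /size0nil -> z; rewrite /=; split; case: ltP; case: leP.
(* The quotient is linear, and its sign at the last point of a locates its root. *)
have last_a : last x0 a = last 0 a by case: (a) a_gt0.
have lt_y : y < last x0 a.
  rewrite last_a; have := alt (size a).-1; rewrite nth_last prednK // leqnn.
  move=> /(_ isT); rewrite Gq hornerM qE hornerZ hornerXsubC -/(prodX b) prodX_sign.
  have -> : count (> last 0 a) b = size a.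
    by rewrite -sz_b; apply/eqP; rewrite -all_count -last_a.
  rewrite mulrCA (mulrA ((-1) ^+ _)) -expr2 sqrr_sign mul1r lcq.
  have norm_ge0 := normr_ge0 (prodX b).[last 0 a]; rewrite !ltNge.
  apply: contraNN => le_y; rewrite -mulrA pmulr_rle0 // mulr_le0_ge0 //; lra.
have gt_last x : x \in a -> last x0 a <= x.
  move=> ax; rewrite last_a -nth_last -(nth_index 0 ax).
  apply: (@sorted_leq_nth _ >=%R); rewrite ?inE ?index_mem ?prednK //.
  - exact: rev_trans le_trans.
  - exact: lexx.
  - by rewrite -ltnS prednK // index_mem.
move=> z; have [ab1' ab2'] := ab z; rewrite /=.
have gt_y x : x \in a ++ b -> y < x.
  rewrite mem_cat => /orP[/gt_last | /(allP last_b) /ltW]; exact: lt_le_trans.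
split.
  case: ltP => //= lt_zy; rewrite add1n.
  have /eqP -> : count (> z) a == size a.
    rewrite -all_count; apply/allP => x ax /=.
    by rewrite (lt_trans lt_zy) ?gt_y ?mem_cat ?ax.
  have /eqP -> : count (> z) b == size b.
    rewrite -all_count; apply/allP => x bx /=.
    by rewrite (lt_trans lt_zy) ?gt_y ?mem_cat ?bx ?orbT.
  by rewrite sz_b leqnn leqnSn.
case: leP => //= le_zy; rewrite add1n.
have /eqP -> : count (>= z) a == size a.
  rewrite -all_count; apply/allP => x ax /=.
  by rewrite (le_trans le_zy) ?ltW ?gt_y ?mem_cat ?ax.
have /eqP -> : count (>= z) b == size b.
  rewrite -all_count; apply/allP => x bx /=.
  by rewrite (le_trans le_zy) ?ltW ?gt_y ?mem_cat ?bx ?orbT.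
by rewrite sz_b leqnn leqnSn.
Qed.
End InterlacedRoots.

(** * The cone of interlacing polynomials *)

Section Cone.
Variable R : rcfType.
Implicit Types (a b : seq R) (f g h p : {poly R}) (x z : R).

Definition nonpos_rooted f : Prop :=
  exists c a, [/\ 0 <= c, all (<= 0) a & f = c *: prodX a].

(** As in [interlaces], the zero polynomial is comparable with every other one on
    either side, so that empty sums need no special treatment. *)
Definition prec f g : Prop :=
  [/\ nonpos_rooted f, nonpos_rooted g & f != 0 -> g != 0 ->
   exists a b, [/\ f = lead_coef f *: prodX a, g = lead_coef g *: prodX b
                 & interlaced a b]].

Local Notation "f ⊴ g" := (prec f g) (at level 70, no associativity).

Lemma nonpos_rooted0 : nonpos_rooted 0.
Proof. by exists 0, [::]; rewrite scale0r. Qed.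

Lemma nonpos_rootedZ c f : 0 <= c -> nonpos_rooted f -> nonpos_rooted (c *: f).
Proof.
move=> c0 [e [a [e0 a0 ->]]]; exists (c * e), a.
by rewrite mulr_ge0 // scalerA.
Qed.

Lemma nonpos_rooted_roots f a : f != 0 -> nonpos_rooted f ->
  f = lead_coef f *: prodX a -> 0 < lead_coef f /\ all (<= 0) a.
Proof.
move=> f0 [c [a' [c_ge0 a'0 fE]]] faE.
have lcE : lead_coef f = c by rewrite fE lead_coef_prodX.
have c_neq0 : c != 0 by rewrite -lcE lead_coef_eq0.
split; first by rewrite lcE lt_neqAle eq_sym c_neq0.
have/perm_all -> // : perm_eq a a'.
apply: prod_XsubC_eq; apply: (scalerI c_neq0).
by rewrite -/(prodX a) -/(prodX a') -fE -lcE -faE.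
Qed.

Lemma nonpos_rootedP f : f != 0 -> nonpos_rooted f -> exists a,
  [/\ 0 < lead_coef f, all (<= 0) a & f = lead_coef f *: prodX a].
Proof.
move=> f0 rf; have [c [a [c0 a0 fE]]] := rf; exists a.
have faE : f = lead_coef f *: prodX a by rewrite {1}fE {1}fE lead_coef_prodX.
by have [] := nonpos_rooted_roots f0 rf faE.
Qed.

Lemma roots_perm f a b : f != 0 -> f = lead_coef f *: prodX a ->
  f = lead_coef f *: prodX b -> perm_eq a b.
Proof.
move=> f0 fa fb; apply: prod_XsubC_eq; apply: (@scalerI _ _ (lead_coef f)).
  by rewrite lead_coef_eq0.
by rewrite -/(prodX a) -/(prodX b) -fa -fb.
Qed.

Lemma precP f g a b : f != 0 -> g != 0 -> f ⊴ g ->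
  f = lead_coef f *: prodX a -> g = lead_coef g *: prodX b -> interlaced a b.
Proof.
move=> f0 g0 [_ _ /(_ f0 g0)[a' [b' [fa' gb' ab]]]] fa gb.
exact: interlaced_perm (roots_perm f0 fa' fa) (roots_perm g0 gb' gb) ab.
Qed.

Lemma prec_refl f : nonpos_rooted f -> f ⊴ f.
Proof.
move=> rf; split=> // f0 _; have [a [_ _ fE]] := nonpos_rootedP f0 rf.
by exists a, a; split=> //; apply: interlaced_refl.
Qed.

Lemma prec0f g : nonpos_rooted g -> 0 ⊴ g.
Proof. by move=> rg; split; rewrite ?eqxx //; apply: nonpos_rooted0. Qed.

Lemma precf0 f : nonpos_rooted f -> f ⊴ 0.
Proof. by move=> rf; split; rewrite ?eqxx //; apply: nonpos_rooted0. Qed.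

Lemma precZ c e f g : 0 <= c -> 0 <= e -> f ⊴ g -> c *: f ⊴ e *: g.
Proof.
move=> c0 e0 [rf rg fg]; split; try exact: nonpos_rootedZ.
rewrite !scale_poly_eq0 !negb_or => /andP[cn0 fn0] /andP[en0 gn0].
have [a [b [fa gb ab]]] := fg fn0 gn0; exists a, b.
by rewrite !lead_coefZ -!scalerA -fa -gb.
Qed.

Lemma nonpos_rooted_gt0 f x : nonpos_rooted f -> f != 0 -> 0 < x -> 0 < f.[x].
Proof.
move=> rf f0 x0; have [a [lc a0 ->]] := nonpos_rootedP f0 rf.
rewrite hornerZ mulr_gt0 //; apply: prodX_gt0.
by apply/allP => y /(allP a0) /= /le_lt_trans; apply.
Qed.

(** The upper neighbours of a nonzero polynomial form a convex cone. *)
Lemma precDr f g h : f != 0 -> f ⊴ g -> f ⊴ h -> f ⊴ g + h.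
Proof.
move=> f0 fg fh; have [-> | g0] := eqVneq g 0; first by rewrite add0r.
have [-> | h0] := eqVneq h 0; first by rewrite addr0.
have [rf rg _] := fg; have [_ rh _] := fh.
have [a [lcf a0 fa]] := nonpos_rootedP f0 rf.
have [b [lcg b0 gb]] := nonpos_rootedP g0 rg.
have [d [lch d0 hd]] := nonpos_rootedP h0 rh.
have [e [t [e0 ghE abt]]] :=
  interlaced_sum lcg lch (precP f0 g0 fg fa gb) (precP f0 h0 fh fa hd).
rewrite -gb -hd in ghE.
split=> // [|_ _]; last by exists a, t; split=> //; rewrite {1}ghE ghE lead_coef_prodX.
exists e, t; split=> //; first exact: ltW.
apply/allP => x tx /=; rewrite leNgt; apply/negP => x0.
have : 0 < (g + h).[x] by rewrite hornerD addr_gt0 ?nonpos_rooted_gt0.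
rewrite ghE hornerZ -(prodX_eq0 x t) in tx *.
by rewrite (eqP (_ : (prodX t).[x] == 0)) ?mulr0 ?ltxx // prodX_eq0.
Qed.

Lemma nonpos_rooted_mulX f : nonpos_rooted f -> nonpos_rooted ('X * f).
Proof.
move=> [c [a [c0 a0 ->]]]; exists c, (0 :: a); rewrite /= lexx a0.
by rewrite prodX_cons subr0 -scalerAr.
Qed.

Lemma nonpos_rooted_divX f : nonpos_rooted ('X * f) -> nonpos_rooted f.
Proof.
have [-> _ | f0] := eqVneq f 0; first exact: nonpos_rooted0.
move=> [c [a [c0 a0 fE]]]; have ra : 0 \in a.
  rewrite -root_prod_XsubC -(@rootZ _ _ c) -?/(prodX a) -?fE.
    by rewrite rootE hornerM hornerX mul0r.
  by apply: contraNneq f0 => cz; move/eqP: fE; rewrite cz scale0r mulf_eq0 polyX_eq0.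
exists c, (rem 0 a); split=> //; first by apply/allP => x /mem_rem /(allP a0).
apply: (mulfI (negbT (polyX_eq0 R))); rewrite fE (prodX_perm (perm_to_rem ra)).
by rewrite prodX_cons subr0 -scalerAr.
Qed.

Lemma count_nonpos a z : all (<= 0) a -> 0 <= z -> count (> z) a = 0%N.
Proof.
move=> /allP a0 z0; apply/eqP; rewrite -leqn0 leqNgt -has_count.
by apply/hasP => -[x /a0 /= x0]; rewrite ltNge (le_trans x0).
Qed.

Lemma count_ge_nonpos a z : all (<= 0) a -> 0 < z -> count (>= z) a = 0%N.
Proof.
move=> /allP a0 z0; apply/eqP; rewrite -leqn0 leqNgt -has_count.
by apply/hasP => -[x /a0 /= x0]; rewrite leNgt (le_lt_trans x0).
Qed.

(** Multiplying by ['X] adds a largest root, hence turns an upper neighbour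
    into a lower one.  This exchanges the two arguments of every statement
    about [prec]. *)
Lemma prec_mulX f g : f ⊴ g <-> g ⊴ 'X * f.
Proof.
have [-> | f0] := eqVneq f 0.
  by rewrite mulr0; split=> -[*]; [apply: precf0 | apply: prec0f].
have [-> | g0] := eqVneq g 0.
  split=> -[*]; [apply: prec0f; exact: nonpos_rooted_mulX|].
  by apply: precf0; apply: nonpos_rooted_divX.
have Xf0 : 'X * f != 0 by rewrite mulf_neq0 ?polyX_eq0.
have lcXf : lead_coef ('X * f) = lead_coef f by rewrite mulrC lead_coefMX.
have XfE a : f = lead_coef f *: prodX a ->
    'X * f = lead_coef ('X * f) *: prodX (0 :: a).
  by move=> fa; rewrite lcXf prodX_cons subr0 {1}fa scalerAr.
split=> fg; have [rf rg _] := fg.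
  have [a [_ a0 fa]] := nonpos_rootedP f0 rf.
  have [b [_ b0 gb]] := nonpos_rootedP g0 rg.
  split=> //; [exact: nonpos_rooted_mulX | move=> _ _; exists b, (0 :: a)].
  split=> //; [exact: XfE | move=> z].
  have /= [] := precP f0 g0 fg fa gb z.
  case: (leP 0 z) => [z0 | z0].
    rewrite !count_nonpos //; case: (ltgtP 0 z) z0 => // [z0|<-] _.
      by rewrite !count_ge_nonpos.
    move: (count _ a) (count _ b) => s t; lia.
  move: (count (> z) a) (count (> z) b) (count _ a) (count _ b) => s t u v.
  by rewrite (ltW z0); lia.
have rf' := nonpos_rooted_divX rg.
have [a [_ a0 fa]] := nonpos_rootedP f0 rf'.
have [b [_ b0 gb]] := nonpos_rootedP g0 rf.
split=> // _ _; exists a, b; split=> // z.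
have /= [] := precP g0 Xf0 fg gb (XfE _ fa) z.
case: (leP 0 z) => [z0 | z0].
  rewrite !count_nonpos //; case: (ltgtP 0 z) z0 => // [z0|<-] _.
    by rewrite !count_ge_nonpos.
  move: (count _ a) (count _ b) => s t; lia.
move: (count (> z) a) (count (> z) b) (count _ a) (count _ b) => s t u v.
by rewrite (ltW z0); lia.
Qed.

Lemma prec_mulXr f g : f ⊴ g -> g ⊴ 'X * f.
Proof. by move=> /prec_mulX. Qed.

Lemma prec_mulX2 f g : f ⊴ g -> 'X * f ⊴ 'X * g.
Proof. by move=> /prec_mulX /prec_mulX. Qed.

Lemma precDl f g h : h != 0 -> f ⊴ h -> g ⊴ h -> f + g ⊴ h.
Proof.
by move=> h0 /prec_mulX fh /prec_mulX gh; apply/prec_mulX; rewrite mulrDr; apply: precDr.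
Qed.

Lemma nonpos_rootedD f g : f ⊴ g -> nonpos_rooted (f + g).
Proof.
move=> fg; have [rf rg _] := fg.
have [-> | f0] := eqVneq f 0; first by rewrite add0r.
by have [] := precDr f0 (prec_refl rf) fg.
Qed.

Lemma prec_addr f g h : nonpos_rooted (g + h) -> f ⊴ g -> f ⊴ h -> f ⊴ g + h.
Proof.
by move=> rgh; have [-> *|] := eqVneq f 0; [apply: prec0f | apply: precDr].
Qed.

Lemma prec_addl f g h : nonpos_rooted (f + g) -> f ⊴ h -> g ⊴ h -> f + g ⊴ h.
Proof.
by move=> rgh; have [-> *|] := eqVneq h 0; [apply: precf0 | apply: precDl].
Qed.

Lemma prec_sumr (J : finType) (D : pred J) f (G : J -> {poly R}) :
    nonpos_rooted f -> nonpos_rooted (\sum_(j | D j) G j) ->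
    (forall j, D j -> f ⊴ G j) ->
  f ⊴ \sum_(j | D j) G j.
Proof.
move=> rf rG fG; have [-> | f0] := eqVneq f 0; first exact: prec0f.
elim/big_ind: _ => //; first exact: precf0.
by move=> *; apply: precDr.
Qed.

Lemma prec_suml (J : finType) (D : pred J) g (F : J -> {poly R}) :
    nonpos_rooted g -> nonpos_rooted (\sum_(j | D j) F j) ->
    (forall j, D j -> F j ⊴ g) ->
  \sum_(j | D j) F j ⊴ g.
Proof.
move=> rg rF Fg; have [-> | g0] := eqVneq g 0; first exact: precf0.
elim/big_ind: _ => //; first exact: prec0f.
by move=> *; apply: precDl.
Qed.

Lemma prec_sum (I J : finType) (D : pred I) (E : pred J) F G :
    nonpos_rooted (\sum_(i | D i) F i) -> nonpos_rooted (\sum_(j | E j) G j) ->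
    (forall i j, D i -> E j -> F i ⊴ G j) ->
  \sum_(i | D i) F i ⊴ \sum_(j | E j) G j.
Proof.
move=> rF rG FG; have [j0 Ej0 | noE] := pickP E; last first.
  by rewrite [X in _ ⊴ X]big_pred0 //; apply: precf0.
apply: prec_suml => // i Di; apply: prec_sumr => // [|j Ej]; last exact: FG.
by have [] := FG i j0 Di Ej0.
Qed.

Section Chains.
Variables (I : finType) (key : I -> nat).
Implicit Types (F B C : I -> {poly R}) (D : pred I) (r : I -> I -> bool).

Definition increasing F : Prop := forall i j, (key i <= key j)%N -> F i ⊴ F j.

(** A nonzero summand of least key is a lower neighbour of all others, hence of
    their sum, which is therefore real-rooted. *)
Lemma nonpos_rooted_sum F D : increasing F -> nonpos_rooted (\sum_(i | D i) F i).
Proof.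
move=> incF; rewrite (bigID (fun i => F i == 0)) /=.
rewrite big1 ?add0r; last by move=> i /andP[_ /eqP].
case: (pickP (fun i => D i && (F i != 0))) => [i0 Di0 | no]; last first.
  by rewrite big_pred0 //; apply: nonpos_rooted0.
pose D' i := D i && (F i != 0).
case: (@arg_minnP _ i0 D' key Di0) => i /andP[Di Fi0] min_i.
have rF j : nonpos_rooted (F j) by have [] := incF j j (leqnn _).
suff [] : F i ⊴ \sum_(j | D j && (F j != 0)) F j by [].
elim/big_ind: _ => [|g h|j Dj]; first exact/precf0.
  exact: precDr.
exact/incF/min_i.
Qed.

Lemma increasing_mulX F : increasing F -> increasing (fun i => 'X * F i).
Proof. by move=> incF i j le_ij; apply/prec_mulX2/incF. Qed.

(** The invariant of the transfer recursion: the sequence of all [C]s followed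
    by all [B]s is interlacing, and so is the sequence of the [B + 'X * C].
    Here [B i] stands for the paths that start at [i] and whose first step is not
    a descent, ['X * C i] for those whose first step is one. *)
Definition transfer_invariant B C : Prop :=
  [/\ increasing B, increasing C, increasing (fun i => B i + 'X * C i)
    & forall i j, C i ⊴ B j].

Lemma transfer_invariantZ B C (w : I -> R) : (forall i, 0 <= w i) ->
  transfer_invariant B C ->
  transfer_invariant (fun i => w i *: B i) (fun i => w i *: C i).
Proof.
move=> w0 [incB incC incA CB]; split=> i j *; try by apply: precZ; auto.
by rewrite -!scalerAr -!scalerDr; apply: precZ; auto.
Qed.

Definition transferB r B C i : {poly R} := \sum_(j | ~~ r i j) (B j + 'X * C j).
Definition transferC r B i : {poly R} := \sum_(j | r i j) B j.

(** The relation is a Ferrers board, when rows and columns are listed by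
    increasing [key].  The condition is invariant under transposing [r] and
    reversing the order of the keys. *)
Definition staircase r : Prop := forall i i' j j',
  (key i <= key i')%N -> (key j' <= key j)%N -> r i j -> r i' j'.

Section Invariant.
Variables (B C : I -> {poly R}) (r : I -> I -> bool).
Hypotheses (inv : transfer_invariant B C) (stair : staircase r).

Let A i := B i + 'X * C i.

Let incB : increasing B. Proof. by case: inv. Qed.
Let incC : increasing C. Proof. by case: inv. Qed.
Let incA : increasing A. Proof. by case: inv. Qed.
Let CB i j : C i ⊴ B j. Proof. by case: inv. Qed.
Let rA i : nonpos_rooted (A i). Proof. by have [] := incA (leqnn (key i)). Qed.
Let BXC i j : B i ⊴ 'X * C j. Proof. exact/prec_mulXr/CB. Qed.

Lemma prec_BA i j : (key i <= key j)%N -> B i ⊴ A j.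
Proof. by move=> le_ij; apply: prec_addr; [exact: rA | exact: incB | exact: BXC]. Qed.

(** Summing over a common set of indices needs no comparison of the indices:
    the sum of the [A]s differs from that of the [B]s by that of the ['X * C]s. *)
Lemma prec_sum_BA D : \sum_(i | D i) B i ⊴ \sum_(i | D i) A i.
Proof.
rewrite big_split /= -/(A _); apply: prec_addr.
- by rewrite -big_split; apply: (nonpos_rooted_sum D incA).
- exact/prec_refl/nonpos_rooted_sum.
apply: prec_sum => //; first exact: nonpos_rooted_sum.
exact/nonpos_rooted_sum/increasing_mulX.
Qed.

Lemma transfer_sub i j k : (key i <= key j)%N -> r i k -> r j k.
Proof. by move=> le_ij; apply: stair. Qed.

Lemma key_split i j k : r i k -> ~~ r i j -> (key k <= key j)%N.
Proof.
move=> rik; apply: contraNleq => lt_jk.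
by apply: stair rik => //; apply: ltnW.
Qed.

(** For two indices [i], [j] with [key i <= key j], the rows [r i] and [r j]
    divide the summation range into three consecutive blocks.  Sums over distinct
    blocks are compared termwise, and so are sums over the same block, except
    that the [A]s of the middle block are compared with its [B]s by
    [prec_sum_BA]. *)
Lemma transfer_invariant_step :
  transfer_invariant (transferB r B C) (transferC r B).
Proof.
have sumA D : nonpos_rooted (\sum_(i | D i) A i) by apply: nonpos_rooted_sum.
have sumB D : nonpos_rooted (\sum_(i | D i) B i) by apply: nonpos_rooted_sum.
have XsumB D : nonpos_rooted ('X * \sum_(i | D i) B i).
  exact: nonpos_rooted_mulX.
pose mid i j k := r j k && ~~ r i k.
have splitC i j : (key i <= key j)%N ->
    transferC r B j = transferC r B i + \sum_(k | mid i j k) B k.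
  move=> le_ij; rewrite /transferC (bigID (r i)) /=; congr (_ + _).
  apply: eq_bigl => k; apply/andP/idP => [[] // | rik].
  by split=> //; apply: transfer_sub rik.
have splitB i j : (key i <= key j)%N ->
    transferB r B C i = \sum_(k | mid i j k) A k + transferB r B C j.
  move=> le_ij; rewrite /transferB (bigID (r j)) /=; congr (_ + _).
    by apply: eq_bigl => k; rewrite /mid andbC.
  apply: eq_bigl => k; apply/andP/idP => [[] // | nrjk].
  by split=> //; apply: contraNN nrjk; apply: transfer_sub.
split.
- move=> i j le_ij; rewrite (splitB i j) //; apply: prec_addl.
  + by rewrite -splitB //; apply: sumA.
  + apply: prec_sum => // k l /andP[rjk _] nrjl.
    exact/incA/(key_split rjk nrjl).
  + exact/prec_refl/sumA.
- move=> i j le_ij; rewrite (splitC i j) //; apply: prec_addr.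
  + by rewrite -splitC //; apply: sumB.
  + exact/prec_refl/sumB.
  + apply: prec_sum => // k l rik /andP[_ nril].
    exact/incB/(key_split rik nril).
- move=> i j le_ij; rewrite (splitB i j) // (splitC i j) //.
  set b := \sum_(k | _) A k; set h := \sum_(k | _) B k.
  set a := transferB r B C j; set c := transferC r B i.
  have ba : b ⊴ a.
    by apply: prec_sum => // k l /andP[rjk _] /(key_split rjk)/incA.
  have bc : b ⊴ 'X * c.
    by apply/prec_mulXr/prec_sum => // k l rik /andP[_ /(key_split rik)/prec_BA].
  have bh : b ⊴ 'X * h by apply/prec_mulXr/prec_sum_BA.
  have ch : 'X * c ⊴ 'X * h.
    by apply/prec_mulX2/prec_sum => // k l rik /andP[_ /(key_split rik)/incB].
  have lt_ij k l : r i k -> ~~ r j l -> (key k <= key l)%N.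
    by move=> rik; apply/key_split/(transfer_sub le_ij rik).
  have ac : a ⊴ 'X * c.
    by apply/prec_mulXr/prec_sum => // k l rik /(lt_ij _ _ rik)/prec_BA.
  have ah : a ⊴ 'X * h.
    by apply/prec_mulXr/prec_sum => // k l /andP[rjk _] /(key_split rjk)/prec_BA.
  have rp := nonpos_rootedD ac; set p := a + 'X * c in rp.
  have bp : b ⊴ p by apply: prec_addr.
  have ph : p ⊴ 'X * h by apply: prec_addl.
  rewrite mulrDr -addrA [X in _ ⊴ X]addrA -/p.
  apply: prec_addr; first exact: nonpos_rootedD.
    by apply: prec_addl; [exact: nonpos_rootedD| | exact: prec_refl].
  by apply: prec_addl => //; exact: nonpos_rootedD.
have mono i j k l : (key i <= key j)%N -> r i k -> ~~ r j l -> C k ⊴ C l /\ B k ⊴ A l.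
  move=> le_ij rik /(key_split (transfer_sub le_ij rik)) le_kl.
  by split; [apply: incC | apply: prec_BA].
move=> i j; case: (leqP (key i) (key j)) => [le_ij | /ltnW le_ji].
  by apply: prec_sum => // k l rik /(mono _ _ _ _ le_ij rik)[].
rewrite (splitC j i) // (splitB j i) //.
set b := \sum_(k | _) A k; set h := \sum_(k | _) B k.
set a := transferB r B C i; set c := transferC r B j.
have cb : c ⊴ b.
  by apply: prec_sum => // k l rjk /andP[_ /(key_split rjk)/prec_BA].
have ca : c ⊴ a.
  by apply: prec_sum => // k l rjk /(mono _ _ _ _ le_ji rjk)[].
have ha : h ⊴ a.
  by apply: prec_sum => // k l /andP[rik _] /(key_split rik)/prec_BA.
have hb : h ⊴ b by apply: prec_sum_BA.
have rba : nonpos_rooted (b + a) by rewrite -splitB //; apply: sumA.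
apply: prec_addl; [by rewrite -splitC //; apply: sumB | exact: prec_addr | exact: prec_addr].
Qed.

End Invariant.
End Chains.
End Cone.

(** * Bit sequences, stable sums and weighted paths *)

Local Notation "f ⊴ g" := (prec f g) (at level 70, no associativity).

Section BitSums.
Variable V : nmodType.
Implicit Types (F G : bitseq -> V) (S T : bitseq).

(** Bit sequences encode sets of ranks, and the sum runs over the subsets of [T]. *)
Fixpoint subsum F T : V :=
  if T is b :: T' then
    (if b then subsum (F \o cons true) T' else 0) + subsum (F \o cons false) T'
  else F [::].

Definition bitsum m F : V := subsum F (nseq m true).

Lemma eq_subsum F G T : (forall S, size S = size T -> F S = G S) ->
  subsum F T = subsum G T.
Proof.
elim: T F G => [|b T IHT] F G FG; first exact: FG.
congr (_ + _); last by apply: IHT => S sz; apply: FG; rewrite /= sz.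
by case: b FG => // FG; apply: IHT => S sz; apply: FG; rewrite /= sz.
Qed.

Lemma eq_bitsum m F G : (forall S, size S = m -> F S = G S) ->
  bitsum m F = bitsum m G.
Proof. by move=> FG; apply: eq_subsum => S; rewrite size_nseq; apply: FG. Qed.

Lemma subsum_sum (I : Type) (s : seq I) (P : pred I) (F : I -> bitseq -> V) T :
  subsum (fun S => \sum_(i <- s | P i) F i S) T = \sum_(i <- s | P i) subsum (F i) T.
Proof.
elim: T F => //= b T IHT F; rewrite big_split /=; congr (_ + _).
  by case: b; [apply: (IHT (fun i => F i \o cons true)) | rewrite big1].
exact: (IHT (fun i => F i \o cons false)).
Qed.

Lemma subsumD F G T : subsum (fun S => F S + G S) T = subsum F T + subsum G T.
Proof.
elim: T F G => //= b T IHT F G.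
rewrite (IHT (F \o cons false) (G \o cons false)) addrACA; congr (_ + _).
by case: b; [rewrite (IHT (F \o cons true) (G \o cons true)) | rewrite addr0].
Qed.

Lemma subsum0 T : subsum (fun=> 0) T = 0.
Proof. by elim: T => //= b T IHT; rewrite IHT addr0 if_same. Qed.

Lemma bitsumS m F :
  bitsum m.+1 F = bitsum m (F \o cons true) + bitsum m (F \o cons false).
Proof. by []. Qed.

Lemma subsum_rcons F T b : subsum F (rcons T b) =
  (if b then subsum (F \o rcons^~ true) T else 0) + subsum (F \o rcons^~ false) T.
Proof.
elim: T F => //= c T IHT F; rewrite !IHT {IHT}.
by case: b c => -[]; rewrite ?addr0 ?add0r // addrACA.
Qed.

Lemma subsum_rev F T : subsum F (rev T) = subsum (F \o rev) T.
Proof.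
elim: T F => // b T IHT F; rewrite rev_cons subsum_rcons !IHT /=.
by congr (_ + _); [case: b => // | ]; apply: eq_subsum => S _; rewrite /= rev_cons.
Qed.

Lemma bitsum_rev m F : bitsum m (F \o rev) = bitsum m F.
Proof. by rewrite /bitsum -subsum_rev rev_nseq. Qed.

End BitSums.

Lemma raddf_subsum (U V : nmodType) (f : {additive U -> V}) F T :
  f (subsum F T) = subsum (f \o F) T.
Proof.
elim: T F => //= b T IHT F; rewrite raddfD !IHT; congr (_ + _).
by case: b; rewrite ?raddf0 // IHT.
Qed.

Lemma mulr_subsum (A : pzRingType) (c : A) F T :
  c * subsum F T = subsum (fun S => c * F S) T.
Proof. exact: (raddf_subsum (c \*o idfun)). Qed.

Lemma scaler_subsum (A : pzRingType) (V : lmodType A) (c : A) (F : bitseq -> V) T :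
  c *: subsum F T = subsum (fun S => c *: F S) T.
Proof. exact: (raddf_subsum (c \*: idfun)). Qed.

Section StableMonomials.
Variable R : nzRingType.
Implicit Types (S : bitseq) (ok b : bool).

(** A bit sequence without two consecutive ones contributes its number of ones;
    with [ok = false] its first bit must vanish as well, as if it were preceded
    by a one. *)
Definition stable_mon ok S : {poly R} :=
  if path (fun b c => ~~ (b && c)) (~~ ok) S then 'X^(count id S) else 0.

Lemma stable_mon_nil ok : stable_mon ok [::] = 1.
Proof. by []. Qed.

Lemma stable_mon_false ok S : stable_mon ok (false :: S) = stable_mon true S.
Proof. by rewrite /stable_mon /= andbF. Qed.

Lemma stable_mon_true ok S :
  stable_mon ok (true :: S) = if ok then 'X * stable_mon false S else 0.
Proof.
by rewrite /stable_mon /= andbT negbK; case: ok => //=; case: ifP; rewrite ?mulr0 // exprS.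
Qed.

Lemma stable_mon_rev S : stable_mon true (rev S) = stable_mon true S.
Proof.
have pathE T : path (fun b c => ~~ (b && c)) (~~ true) T =
    sorted (fun b c => ~~ (b && c)) T by case: T.
rewrite /stable_mon !pathE rev_sorted count_rev; congr (if _ then _ else _).
by apply: eq_sorted => b c; rewrite andbC.
Qed.

End StableMonomials.

(** The gamma-polynomials, written as sums over descent sets. *)
Definition stable_sum (R : nzRingType) ok m (beta : bitseq -> nat) : {poly R} :=
  bitsum m (fun S => (beta S)%:R *: stable_mon R ok S).

Section PathCounts.
Variable I : finType.
Implicit Types (w : nat -> I -> nat) (r : nat -> I -> I -> bool) (u v : I -> nat).

(** A path i_k, i_{k+1}, ... has the weight [w] of all its entries but the first,
    and the weight [v] of its last one; the bits record which pairs of consecutive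
    entries are related. *)
Fixpoint paths_from w r v k i S : nat :=
  if S is b :: S' then
    (\sum_(j | r k i j == b) w k.+1 j * paths_from w r v k.+1 j S')%N
  else v i.

Definition path_count w r v S : nat := (\sum_i w 0%N i * paths_from w r v 0 i S)%N.

(** Prescribing a last bit [b] amounts to changing the weights of the ends. *)
Definition push_back w r v k b i : nat := (\sum_(j | r k i j == b) w k.+1 j * v j)%N.

Lemma paths_from_rcons w r v k i S b :
  paths_from w r v k i (rcons S b) =
  paths_from w r (push_back w r v (k + size S) b) k i S.
Proof.
elim: S k i => [|c S IHS] k i /=; first by rewrite addn0.
by apply: eq_bigr => j _; rewrite IHS addSnnS.
Qed.

(** The weights and relations for which reading the paths of the given system
    backwards gives paths; [m] is the number of steps. *)
Definition rev_weight m w k : I -> nat := w (m - k)%N.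
Definition rev_rel m r k : I -> I -> bool := fun i j => r (m.-1 - k)%N j i.

Lemma paths_from_rev m w r u v k S : (k + size S <= m)%N ->
  (\sum_i w k i * u i * paths_from w r v k i S =
   \sum_j w (k + size S) j * v j *
     paths_from (rev_weight m w) (rev_rel m r) u (m - (k + size S)) j (rev S))%N.
Proof.
elim: S k u => [|b S IHS] k u /= le_km.
  by rewrite addn0; apply: eq_bigr => i _; rewrite mulnAC.
pose u' := push_back (rev_weight m w) (rev_rel m r) u (m - k.+1) b.
transitivity (\sum_j w k.+1 j * u' j * paths_from w r v k.+1 j S)%N.
  under eq_bigr => i _ do rewrite big_distrr.
  rewrite (exchange_big_dep predT) //=; apply: eq_bigr => j _.
  have -> : u' j = (\sum_(i | r k i j == b) w k i * u i)%N.
    rewrite /u' /push_back /rev_rel /rev_weight.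
    have -> : (m.-1 - (m - k.+1) = k)%N by move: le_km; clear; lia.
    by have -> : ((m - (m - k.+1).+1) = k)%N by move: le_km; clear; lia.
  by rewrite mulnAC big_distrr; apply: eq_bigr => i _; rewrite mulnC.
rewrite IHS ?addSnnS //; apply: eq_bigr => j _; congr (_ * _)%N.
rewrite rev_cons paths_from_rcons size_rev.
by have -> : (m - (k + (size S).+1) + size S = m - k.+1)%N
  by move: (size S) le_km => s; clear; lia.
Qed.

Lemma path_count_rev m w r S : size S = m ->
  path_count (rev_weight m w) (rev_rel m r) (fun=> 1%N) (rev S) =
  path_count w r (fun=> 1%N) S.
Proof.
move=> szS; rewrite /path_count.
transitivity (\sum_i w 0 i * 1 * paths_from w r (fun=> 1) 0 i S)%N.
  rewrite (@paths_from_rev m) add0n szS // subnn.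
  by apply: eq_bigr => i _; rewrite muln1 /rev_weight subn0.
by apply: eq_bigr => i _; rewrite muln1.
Qed.

Variable R : rcfType.

Section Backward.
Variables (key : I -> nat) (w : nat -> I -> nat) (r : nat -> I -> I -> bool).
Hypothesis stair : forall k, staircase key (r k).

Let level v m k ok i := stable_sum R ok m (paths_from w r v k i).

Lemma stable_sum_cons ok m (beta : bitseq -> nat) :
  stable_sum R ok m.+1 beta = stable_sum R true m (beta \o cons false) +
    (if ok then 'X * stable_sum R false m (beta \o cons true) else 0).
Proof.
rewrite /stable_sum bitsumS addrC; congr (_ + _).
  by apply: eq_bitsum => S _; rewrite /= stable_mon_false.
case: ok.
  rewrite /bitsum mulr_subsum.
  by apply: eq_subsum => S _; rewrite /= stable_mon_true -scalerAr.
rewrite -[RHS](subsum0 _ (nseq m true)).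
by apply: eq_subsum => S _; rewrite /= stable_mon_true scaler0.
Qed.

Lemma stable_sum_sum ok m (P : pred I) (c : I -> nat) (beta : I -> bitseq -> nat) :
  stable_sum R ok m (fun S => \sum_(j | P j) c j * beta j S)%N =
  \sum_(j | P j) (c j)%:R *: stable_sum R ok m (beta j).
Proof.
rewrite /stable_sum /bitsum.
transitivity (subsum (fun S => \sum_(j | P j)
    (c j)%:R *: ((beta j S)%:R *: stable_mon R ok S)) (nseq m true)).
  apply: eq_subsum => S _; rewrite natr_sum scaler_suml.
  by apply: eq_bigr => j _; rewrite natrM scalerA.
rewrite subsum_sum; apply: eq_bigr => j _.
by rewrite scaler_subsum.
Qed.

(** One step of a path is one application of [transfer_invariant_step]; for
    paths without steps all polynomials are constant. *)
Lemma level_invariant v m k : exists2 C,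
  transfer_invariant key (level v m k false) C &
  forall i, level v m k true i = level v m k false i + 'X * C i.
Proof.
elim: m k => [|m IHm] k.
  have r1 : nonpos_rooted (1 : {poly R}).
    by exists 1, [::]; rewrite ler01 scale1r /prodX big_nil.
  have const i j : level v 0 k false i ⊴ level v 0 k false j.
    by apply: precZ; rewrite ?ler0n //; apply: prec_refl.
  exists (fun=> 0) => [|i]; last by rewrite mulr0 addr0.
  split=> [i j _|i j _|i j _|i j].
  - exact: const.
  - exact/prec_refl/nonpos_rooted0.
  - by rewrite mulr0 !addr0; apply: const.
  - by apply: prec0f; case: (const j j).
have [C inv AE] := IHm k.+1.
pose w' j : R := (w k.+1 j)%:R.
have := transfer_invariant_step
  (transfer_invariantZ (w := w') (fun j => ler0n _ _) inv) (@stair k).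
set B' := transferB _ _ _; set C' := transferC _ _.
have BE i : level v m.+1 k false i = B' i.
  rewrite /level stable_sum_cons addr0 /B' /transferB.
  rewrite (stable_sum_sum _ _ (fun j => r k i j == false)).
  apply: eq_big => [j | j _]; first by case: (r k i j).
  by rewrite -/(level v m k.+1 true j) AE scalerDr scalerAr.
move=> inv'; exists C' => [|i].
  case: inv' => iB iC iA CB.
  split=> [i j|//|i j|i j]; rewrite ?BE; [exact: iB | exact: iA | exact: CB].
rewrite BE /level stable_sum_cons; congr (_ + _ * _).
  rewrite -BE /level stable_sum_cons addr0 //.
rewrite (stable_sum_sum _ _ (fun j => r k i j == true)) /C' /transferC.
by apply: eq_bigl => j; case: (r k i j).
Qed.

Lemma prec_stable_sum v m :
  stable_sum R false m (path_count w r v) ⊴ stable_sum R true m (path_count w r v).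
Proof.
rewrite /path_count !(stable_sum_sum _ _ xpredT).
have [C inv AE] := level_invariant v m 0.
pose w' j : R := (w 0 j)%:R.
have := prec_sum_BA (transfer_invariantZ (w := w') (fun j => ler0n _ _) inv) xpredT.
congr (_ ⊴ _); apply: eq_bigr => i _.
by rewrite -scalerAr -scalerDr -AE.
Qed.

Lemma prec_stable_sum_rcons m :
  stable_sum R false m (path_count w r (fun=> 1%N) \o rcons^~ false) ⊴
  stable_sum R true m (path_count w r (fun=> 1%N) \o rcons^~ false).
Proof.
have E ok : stable_sum R ok m (path_count w r (fun=> 1%N) \o rcons^~ false) =
    stable_sum R ok m (path_count w r (push_back w r (fun=> 1%N) m false)).
  apply: eq_bitsum => S szS; congr (_%:R *: _); rewrite /= /path_count.
  by apply: eq_bigr => i _; rewrite paths_from_rcons szS.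
by rewrite !E; apply: prec_stable_sum.
Qed.

End Backward.

Lemma eq_stable_sum ok m (b b' : bitseq -> nat) :
  (forall S, size S = m -> b S = b' S) -> stable_sum R ok m b = stable_sum R ok m b'.
Proof. by move=> bb'; apply: eq_bitsum => S szS; rewrite bb'. Qed.

Lemma stable_sum_rev_true m (b : bitseq -> nat) :
  stable_sum R true m (b \o rev) = stable_sum R true m b.
Proof.
rewrite /stable_sum -bitsum_rev; apply: eq_bitsum => S _ /=.
by rewrite revK stable_mon_rev.
Qed.

Lemma stable_sum_rev_false m (b : bitseq -> nat) :
  stable_sum R false m.+1 (b \o rev) = stable_sum R true m (b \o rcons^~ false).
Proof.
rewrite stable_sum_cons addr0 -stable_sum_rev_true; apply: eq_stable_sum => S _ /=.
by rewrite rev_cons revK.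
Qed.

Lemma coef0_stable_sum ok m (b : bitseq -> nat) :
  (stable_sum R ok m b)`_0 = (b (nseq m false))%:R.
Proof.
elim: m ok b => [|m IHm] ok b.
  by rewrite /stable_sum /bitsum /= stable_mon_nil coefZ coefC mulr1.
rewrite stable_sum_cons coefD IHm /=.
by case: ok; rewrite ?coefXM ?coef0 addr0.
Qed.

Section FourRelations.
Variables (key : I -> nat) (w : nat -> I -> nat) (r : nat -> I -> I -> bool) (m : nat).
Hypothesis stair : forall k, staircase key (r k).

Let beta := path_count w r (fun=> 1%N).
Let beta' := path_count (rev_weight m.+1 w) (rev_rel m.+1 r) (fun=> 1%N).
Let key' i := (\max_j key j - key i)%N.

Lemma staircase_rev k : staircase key' (rev_rel m.+1 r k).
Proof.
move=> i i' j j'; rewrite /key' /rev_rel => le_i le_j; apply: stair.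
  by move: le_j (leq_bigmax (F := key) j') (leq_bigmax (F := key) j); lia.
by move: le_i (leq_bigmax (F := key) i) (leq_bigmax (F := key) i'); lia.
Qed.

Lemma betaE S : size S = m.+1 -> beta' S = beta (rev S).
Proof. by move=> szS; rewrite -[S in LHS]revK /beta' path_count_rev ?size_rev. Qed.

(** Forbidding a descent at the first position is the comparison of
    [prec_sum_BA], and forbidding one at the last position becomes the former
    when the paths are read backwards. *)
Theorem prec_stable_sums :
  [/\ stable_sum R false m (beta \o rcons^~ false) ⊴ stable_sum R false m.+1 beta,
      stable_sum R false m (beta \o rcons^~ false)
        ⊴ stable_sum R true m (beta \o rcons^~ false),
      stable_sum R false m.+1 beta ⊴ stable_sum R true m.+1 beta
    & stable_sum R true m (beta \o rcons^~ false) ⊴ stable_sum R true m.+1 beta].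
Proof.
have stair' := staircase_rev; split.
- have := prec_stable_sum_rcons (rev_weight m.+1 w) stair' m; rewrite -/beta'.
  have E ok : stable_sum R ok m (beta' \o rcons^~ false) =
      stable_sum R ok m ((beta \o cons false) \o rev).
    by apply: eq_stable_sum => S szS /=; rewrite betaE ?size_rcons ?szS // rev_rcons.
  rewrite !E stable_sum_rev_true stable_sum_cons addr0; congr (_ ⊴ _).
  case: (m) => // n; rewrite stable_sum_rev_false stable_sum_cons addr0.
  exact: eq_stable_sum.
- exact: prec_stable_sum_rcons.
- exact: prec_stable_sum.
have := prec_stable_sum (rev_weight m.+1 w) stair' (fun=> 1%N) m.+1; rewrite -/beta'.
have E ok : stable_sum R ok m.+1 beta' = stable_sum R ok m.+1 (beta \o rev).
  exact: eq_stable_sum betaE.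
by rewrite !E stable_sum_rev_true stable_sum_rev_false.
Qed.

End FourRelations.
End PathCounts.

(** * From gamma-polynomials to palindromic polynomials *)

Section GammaTransfer.
Variable R : realType.
Implicit Types (f g h : {poly R}) (a b : seq R) (n : nat).

Lemma interlaces_prodX (c e : R) a b : 0 < c -> 0 < e -> interlaced a b ->
  c *: prodX a ≼ e *: prodX b.
Proof.
move=> c0 e0 ab.
have rooted x (s : seq R) : ordered_roots (x *: prodX s) (sort >=%R s).
  split; first by apply: sort_sorted => ? ?; apply: le_total.
  rewrite lead_coef_prodX; congr (_ *: _); apply: prodX_perm.
  by rewrite perm_sym perm_sort.
split=> [||_ _]; [by eexists | by eexists | rewrite !lead_coef_prodX].
split=> //; exists (sort >=%R a), (sort >=%R b).
have {ab} : interlaced (sort >=%R a) (sort >=%R b).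
  by apply: interlaced_perm ab; rewrite perm_sym perm_sort.
have sorted_sort (s : seq R) : sorted >=%R (sort >=%R s).
  by apply: sort_sorted => ? ?; apply: le_total.
move: (sort _ a) (sort _ b) (sorted_sort a) (sorted_sort b) (rooted c a) (rooted e b).
move=> {rooted sorted_sort} a' b' sa sb ra rb ab.
(* In a weakly decreasing list the entries above a threshold come first. *)
have count_le (s : seq R) i z : sorted >=%R s -> s`_i <= z -> (i < size s)%N ->
    (count (> z) s <= i)%N.
  move=> ss le_i lt_i; rewrite -[s](cat_take_drop i) count_cat.
  rewrite [X in (_ + X)%N](_ : _ = 0%N) ?addn0.
    by rewrite (leq_trans (count_size _ _)) // size_take; case: ifP => //; lia.
  apply/eqP; rewrite -leqn0 leqNgt -has_count; apply/hasP => -[x /(nthP 0)[j]].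
  rewrite size_drop nth_drop => lt_j <- /=; rewrite ltNge (le_trans _ le_i) //.
  by apply: (sorted_leq_nth (rev_trans le_trans) lexx 0 ss); rewrite ?inE ?leq_addr // -ltn_subRL.
have count_gt (s : seq R) i z : sorted >=%R s -> z < s`_i -> (i < size s)%N ->
    (i < count (> z) s)%N.
  move=> ss gt_i lt_i; rewrite -[s](cat_take_drop i.+1) count_cat ltn_addr //.
  suff: all (> z) (take i.+1 s).
    by rewrite all_count => /eqP ->; rewrite size_take; case: ifP.
  apply/(all_nthP 0) => j; rewrite size_take => lt_j /=.
  have le_ji : (j <= i)%N by move: lt_j lt_i; case: ifP; clear; lia.
  rewrite nth_take ?ltnS // (lt_le_trans gt_i) //.
  by apply: (sorted_leq_nth (rev_trans le_trans) lexx 0 ss); rewrite ?inE // (leq_ltn_trans le_ji).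
have /andP[sz1 sz2] := interlaced_size ab.
split=> //.
- by move: (size a') (size b') sz1 sz2; clear; lia.
- move=> i lt_ia; rewrite leNgt; apply/negP => lt_ba.
  have [/andP[+ _] _] := ab (b'`_i); apply/negP; rewrite -ltnNge.
  rewrite (leq_ltn_trans (count_le _ i _ _ _ _)) ?count_gt //.
  exact: leq_trans sz1.
move=> i lt_ia lt_ib; rewrite leNgt; apply/negP => lt_ab.
have [/andP[_ +] _] := ab (a'`_i); apply/negP; rewrite -ltnNge.
apply: leq_ltn_trans (count_gt _ _ _ sb lt_ab lt_ib).
by rewrite ltnS count_le.
Qed.

(** An up-closed set of roots is cut out by the half-line starting at its least
    element. *)
Lemma interlaced_upset a b (p : pred R) : interlaced a b ->
    {in a ++ b &, forall x y, x <= y -> p x -> p y} ->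
  (count p a <= count p b <= (count p a).+1)%N.
Proof.
move=> ab up; have [some | ] := boolP (has p (a ++ b)); last first.
  rewrite has_cat negb_or !has_count -!leqNgt !leqn0 => /andP[/eqP -> /eqP ->] //.
have sorted_s : sorted <=%R (sort <=%R (filter p (a ++ b))).
  by apply: sort_sorted => ? ?; apply: le_total.
have mem_s x : (x \in sort <=%R (filter p (a ++ b))) = p x && (x \in a ++ b).
  by rewrite mem_sort mem_filter.
case: (sort _ _) sorted_s mem_s => [|x s] /= path_s mem_s.
  by case/hasP: some => x abx px; have := mem_s x; rewrite px abx.
have /andP[px abx] : p x && (x \in a ++ b) by rewrite -mem_s mem_head.
have min_x : all (>= x) s := order_path_min le_trans path_s.
have pE y : y \in a ++ b -> p y = (x <= y).
  move=> aby; apply/idP/idP => [py | le_xy]; last exact: up px.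
  have : y \in x :: s by rewrite mem_s py.
  by rewrite inE => /predU1P[-> // | /(allP min_x)].
have [_] := ab x; rewrite !(@eq_in_count _ p (>= x)) // => y yab; apply: pE.
all: by rewrite mem_cat yab ?orbT.
Qed.

Let s (r : R) := Num.sqrt (1 - 4 * r).

(** The solution in ]-1, 0[ of t / (1 + t)^2 = r, for r < 0; the other one is
    its inverse. *)
Definition gamma_root r := (1 - s r) / (1 + s r).

Let s_gt1 r : r < 0 -> 1 < s r.
Proof.
by move=> r0; rewrite /s -[X in X < _]sqrtr1 ltr_sqrt; lra.
Qed.

Lemma gamma_root_itv r : r < 0 -> -1 < gamma_root r < 0.
Proof.
move=> /s_gt1; rewrite /gamma_root; move: (s r) => t t1.
by rewrite ltr_pdivlMr ?ltr_pdivrMr; lra.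
Qed.

Lemma gamma_root_mono r r' : r' < 0 -> r <= r' -> gamma_root r <= gamma_root r'.
Proof.
move=> r'0 le_rr'; have r0 := le_lt_trans le_rr' r'0.
have := s_gt1 r0; have := s_gt1 r'0.
have : s r' <= s r by rewrite /s ler_sqrt; lra.
rewrite /gamma_root; move: (s r) (s r') => t t' le_t't t'1 t1.
rewrite ler_pdivrMr; last lra.
rewrite mulrAC ler_pdivlMr; last lra.
nra.
Qed.

Lemma gamma_root_factor r : r < 0 ->
  'X - r *: (1 + 'X) ^+ 2 =
  - r *: (('X - (gamma_root r)%:P) * ('X - (gamma_root r)^-1%:P)) :> {poly R}.
Proof.
move=> r0; have s1 := s_gt1 r0.
have sr : s r ^+ 2 = 1 - 4 * r by rewrite sqr_sqrtr //; lra.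
have r1 : gamma_root r * (gamma_root r)^-1 = 1.
  by rewrite mulfV // lt_eqF //; case/andP: (gamma_root_itv r0).
have r2 : - r * (gamma_root r + (gamma_root r)^-1) = - (1 - 2 * r).
  rewrite /gamma_root invf_div.
  have -> : - r = (s r ^+ 2 - 1) / 4 by rewrite sr; lra.
  have -> : 2 * r = (1 - s r ^+ 2) / 2 by rewrite sr; lra.
  have st_neq0 : (1 - s r != 0) && (1 + s r != 0).
    by rewrite lt_eqF ?gt_eqF //; lra.
  by field; case/andP: st_neq0 => ->.
have -> : ('X - (gamma_root r)%:P) * ('X - (gamma_root r)^-1%:P) =
    'X^2 - (gamma_root r + (gamma_root r)^-1) *: 'X
      + (gamma_root r * (gamma_root r)^-1)%:P :> {poly R}.
  by move: (gamma_root r) (gamma_root r)^-1 => u v; rewrite -mul_polyC polyCD polyCM; ring.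
rewrite r1 scalerDr scalerBr scalerA r2 -!mul_polyC.
rewrite !(polyCN, polyCB, polyCM) polyC1 polyC_natr.
by ring.
Qed.

Definition gamma_roots n a : seq R :=
  map gamma_root a ++ nseq (n - 2 * size a) (-1) ++ map (fun r => (gamma_root r)^-1) a.

Lemma gamma_sumE n g : (size g <= n./2.+1)%N ->
  \sum_(i < n./2.+1) g`_i *: ('X^i * (1 + 'X) ^+ (n - 2 * i)) =
  \sum_(i < size g) g`_i *: ('X^i * (1 + 'X) ^+ (n - 2 * i)).
Proof.
move=> le_g; pose G i := g`_i *: ('X^i * (1 + 'X) ^+ (n - 2 * i)) : {poly R}.
rewrite -[LHS](big_mkord xpredT G) -[RHS](big_mkord xpredT G).
rewrite (big_cat_nat (n := size g)) //= (_ : \sum_(size g <= i < n./2.+1) G i = 0).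
  by rewrite addr0.
rewrite big_nat big1 // /G => i.
by case/andP=> le_i _; rewrite nth_default // scale0r.
Qed.

Lemma gamma_expansion0 n : @gamma_expansion R n 0 0.
Proof. by split; [rewrite size_poly0 | rewrite big1 // => i _; rewrite coef0 scale0r]. Qed.

Lemma gamma_expansionD n f g f' g' : gamma_expansion n f g ->
  gamma_expansion n f' g' -> gamma_expansion n (f + f') (g + g').
Proof.
move=> [szg ->] [szg' ->]; split.
  by rewrite (leq_trans (size_polyD _ _)) // geq_max szg.
by rewrite -big_split; apply: eq_bigr => i _; rewrite coefD scalerDl.
Qed.

Lemma gamma_expansionZ n c f g :
  gamma_expansion n f g -> gamma_expansion n (c *: f) (c *: g).
Proof.
move=> [szg ->]; split; first exact: leq_trans (size_scale_leq _ _) szg.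
by rewrite scaler_sumr; apply: eq_bigr => i _; rewrite coefZ scalerA.
Qed.

Lemma gamma_expansion_mul1X n f g :
  gamma_expansion n f g -> gamma_expansion n.+1 ((1 + 'X) * f) g.
Proof.
move=> [szg fE].
have szg' : (size g <= n.+1./2.+1)%N by rewrite (leq_trans szg) // ltnS half_leq.
split=> //; rewrite fE !gamma_sumE // mulr_sumr; apply: eq_bigr => i _.
rewrite -scalerAr subSn ?exprS ?(mulrCA (1 + 'X)) //.
have /leq_trans/(_ szg) := ltn_ord i; move: (nat_of_ord i) => {szg szg' fE} {}i; lia.
Qed.

Lemma gamma_expansion_mulX n f g :
  gamma_expansion n f g -> gamma_expansion n.+2 ('X * f) ('X * g).
Proof.
move=> [szg fE]; have szXg : (size ('X * g)%R <= n.+2./2.+1)%N.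
  by rewrite (leq_trans (size_polyMleq _ _)) // size_polyX.
split=> //; rewrite big_ord_recl coefXM scale0r add0r /= fE mulr_sumr.
apply: eq_bigr => i _; rewrite coefXM /= /bump /= add1n -scalerAr exprS -mulrA.
by rewrite mulnS !addSn subSS subSS.
Qed.

(** A factor ['X - r] of the gamma-polynomial contributes
    ['X - r *: (1 + 'X) ^+ 2], and powers of [1 + 'X] fill up the degree. *)
Lemma gamma_expansion_prodX n a : (forall r, r \in a -> r < 0) ->
    (2 * size a <= n)%N -> exists2 c, 0 < c &
  gamma_expansion n (c *: prodX (gamma_roots n a)) (prodX a).
Proof.
have prodX_cat (t u : seq R) : prodX (t ++ u) = prodX t * prodX u.
  by rewrite /prodX big_cat.
elim: a n => [|r a IHa] n a_neg /= le_an.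
  exists 1 => //; rewrite /gamma_roots /= cats0 muln0 subn0 scale1r.
  elim: n {le_an a_neg} => [|n IHn].
    rewrite /prodX !big_nil; split; first by rewrite size_poly1.
    by rewrite big_ord1 coefC expr0 mulr1 scale1r.
  by rewrite prodX_cons polyCN opprK polyC1 addrC; apply: gamma_expansion_mul1X.
have r0 : r < 0 by apply: a_neg; rewrite mem_head.
case: n le_an => [|[|n]] le_an; rewrite ?mulnS // in le_an *.
have [c c0 exp_a] := IHa n (fun x xa => a_neg x (@mem_behead _ (r :: a) x xa)) le_an.
exists (- r * c); first by rewrite mulr_gt0 ?oppr_gt0.
have -> : - r * c *: prodX (gamma_roots n.+2 (r :: a)) =
    'X * (c *: prodX (gamma_roots n a)) +
    (- r) *: ((1 + 'X) * ((1 + 'X) * (c *: prodX (gamma_roots n a)))).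
  rewrite /gamma_roots /= mulnS !subSS prodX_cons !prodX_cat prodX_cons.
  set p1 := prodX _; set p2 := prodX _; set p3 := prodX _.
  have := gamma_root_factor r0.
  set u := 'X - (gamma_root r)%:P; set v := 'X - (gamma_root r)^-1%:P => uv.
  transitivity (c *: ((- r *: (u * v)) * (p1 * p2 * p3))).
    by rewrite -!mul_polyC polyCM; ring.
  by rewrite -uv -!mul_polyC polyCN; ring.
rewrite [X in gamma_expansion _ _ X]prodX_cons mulrBl.
have -> : r%:P * prodX a = - (- r *: prodX a) by rewrite scaleNr opprK mul_polyC.
rewrite opprK; apply: gamma_expansionD; first exact: gamma_expansion_mulX.
by apply: gamma_expansionZ; do 2!apply: gamma_expansion_mul1X.
Qed.

(** Roots above -1 are counted directly.  The number of roots above some z < -1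
    is n minus the number of roots r with [gamma_root r] at least 1/z, and the
    excess of 1 of n.+1 over n compensates for the reversal of the comparison. *)
Lemma interlaced_gamma n a b : (forall r, r \in a -> r < 0) ->
    (forall r, r \in b -> r < 0) -> (2 * size a <= n)%N -> (2 * size b <= n.+1)%N ->
    interlaced a b ->
  interlaced (gamma_roots n a) (gamma_roots n.+1 b).
Proof.
move=> a_neg b_neg le_a le_b ab z.
have ab_neg r : r \in a ++ b -> r < 0 by rewrite mem_cat => /orP[/a_neg|/b_neg].
have upset (p : pred R) : (forall x y, x <= y -> p x -> p y) ->
    (count (p \o gamma_root) a <= count (p \o gamma_root) b
       <= (count (p \o gamma_root) a).+1)%N.
  move=> up; apply: interlaced_upset => // x y xab yab le_xy; apply: up.
  by apply: gamma_root_mono => //; apply: ab_neg.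
have inv_lt r : r \in a ++ b -> (gamma_root r)^-1 < -1.
  move=> /ab_neg/gamma_root_itv/andP[gt_r lt_r].
  by rewrite -invrN1 ltf_nV2 ?negrE //; lra.
(* Small roots are counted through their inverses. *)
have low (p q : pred R) (t : seq R) k : {subset t <= a ++ b} ->
    (2 * size t <= k)%N ->
    (forall x, -1 < x < 0 -> p x) -> p (-1) ->
    {in t, forall x, p (gamma_root x)^-1 = ~~ q (gamma_root x)} ->
    count p (gamma_roots k t) =
    (k - count (q \o gamma_root) t)%N.
  move=> sub_t le_t p_mid p1 pq; rewrite /gamma_roots !count_cat !count_map count_nseq p1 mul1n.
  have -> : count (preim gamma_root p) t = size t.
    apply/eqP; rewrite -all_count; apply/allP => x /sub_t/ab_neg x0 /=.
    exact/p_mid/gamma_root_itv.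
  have -> : count (preim (fun r => (gamma_root r)^-1) p) t =
      count (predC (q \o gamma_root)) t.
    by apply: eq_in_count => x xt /=; rewrite pq.
  have := count_predC (q \o gamma_root) t.
  move: (count _ t) (count _ t) (size t) le_t => i j l; clear; lia.
have high (p : pred R) (t : seq R) k : {subset t <= a ++ b} ->
    (forall x, x <= -1 -> ~~ p x) ->
    count p (gamma_roots k t) =
    count (p \o gamma_root) t.
  move=> sub_t np; rewrite /gamma_roots !count_cat !count_map count_nseq.
  rewrite (negPf (np _ (lexx _))).
  rewrite mul0n add0n [X in (_ + X)%N](_ : _ = 0%N) ?addn0 //.
  apply/eqP; rewrite -leqn0 leqNgt -has_count; apply/hasP => -[x /sub_t xt /=].
  by apply/negP/np/ltW/inv_lt.
have sub_a : {subset a <= a ++ b} by move=> x xa; rewrite mem_cat xa.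
have sub_b : {subset b <= a ++ b} by move=> x xb; rewrite mem_cat xb orbT.
have inv_gt x : x < 0 -> z < 0 -> (z < x^-1) = (x < z^-1).
  by move=> x0 z0; rewrite -[z in LHS]invrK ltf_nV2 ?negrE ?invr_lt0.
have inv_ge x : x < 0 -> z < 0 -> (z <= x^-1) = (x <= z^-1).
  by move=> x0 z0; rewrite -[z in LHS]invrK lef_nV2 ?negrE ?invr_lt0.
have neg_root x : x \in a ++ b -> gamma_root x < 0.
  by move=> /ab_neg/gamma_root_itv/andP[].
have count_le (p : pred R) (t : seq R) k : (2 * size t <= k)%N -> (count p t <= k)%N.
  by move=> le_t; rewrite (leq_trans (count_size _ _)) // (leq_trans _ le_t) // leq_pmull.
split.
  case: (ltP z (-1)) => [lt_z | le_z].
    have z0 : z < 0 by lra.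
    have cntE t k : {subset t <= a ++ b} -> (2 * size t <= k)%N ->
        count (> z) (gamma_roots k t) = (k - count ((>= z^-1) \o gamma_root) t)%N.
      move=> sub_t le_t; apply: low => // [x /andP[x1 _] | x /sub_t/neg_root x0] /=.
        exact: lt_trans x1.
      by rewrite -ltNge inv_gt.
    rewrite !cntE //; have := count_le ((>= z^-1) \o gamma_root) a n le_a.
    have := upset (>= z^-1) (fun x y le_xy le_zx => le_trans le_zx le_xy).
    by move: (count _ a) (count _ b) => i j; clear; lia.
  have cntE t k : {subset t <= a ++ b} ->
      count (> z) (gamma_roots k t) = count ((> z) \o gamma_root) t.
    by move=> sub_t; apply: high => // x x1 /=; rewrite -leNgt (le_trans x1).
  rewrite !cntE //; apply: (upset (> z)) => x y le_xy lt_zx /=.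
  exact: lt_le_trans le_xy.
case: (leP z (-1)) => [le_z | lt_z].
  have z0 : z < 0 by lra.
  have cntE t k : {subset t <= a ++ b} -> (2 * size t <= k)%N ->
      count (>= z) (gamma_roots k t) = (k - count ((> z^-1) \o gamma_root) t)%N.
    move=> sub_t le_t; apply: low => // [x /andP[x1 _] | x /sub_t/neg_root x0] /=.
      exact: le_trans (ltW x1).
    by rewrite -leNgt inv_ge.
  rewrite !cntE //; have := count_le ((> z^-1) \o gamma_root) a n le_a.
  have := upset (> z^-1) (fun x y le_xy lt_zx => lt_le_trans lt_zx le_xy).
  by move: (count _ a) (count _ b) => i j; clear; lia.
have cntE t k : {subset t <= a ++ b} ->
    count (>= z) (gamma_roots k t) = count ((>= z) \o gamma_root) t.
  by move=> sub_t; apply: high => // x x1 /=; rewrite -ltNge (le_lt_trans x1).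
rewrite !cntE //; apply: (upset (>= z)) => x y le_xy lt_zx /=.
exact: le_trans le_xy.
Qed.

(** The constant coefficients are required to be nonzero because a root 0 of the
    gamma-polynomial would contribute a single root 0. *)
Theorem prec_interlaces n f f' g g' :
    gamma_expansion n f g -> gamma_expansion n.+1 f' g' ->
    g`_0 != 0 -> g'`_0 != 0 -> g ⊴ g' ->
  f ≼ f' /\ g ≼ g'.
Proof.
have neg h a : h`_0 != 0 -> h = lead_coef h *: prodX a -> all (<= 0) a ->
    forall r, r \in a -> r < 0.
  move=> h0 hE /allP a0 r ra; have /= r_le0 := a0 r ra; rewrite lt_neqAle r_le0 andbT.
  apply: contraNneq h0 => r0; rewrite hE -horner_coef0 hornerZ mulf_eq0.
  by rewrite prodX_eq0 -r0 ra orbT.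
move=> exp_f exp_f' g0 g'0 gg'; have [rg rg' _] := gg'.
have gn0 : g != 0 by apply: contraNneq g0 => ->; rewrite coef0.
have g'n0 : g' != 0 by apply: contraNneq g'0 => ->; rewrite coef0.
have [a [lg a0 gE]] := nonpos_rootedP gn0 rg.
have [b [lg' b0 g'E]] := nonpos_rootedP g'n0 rg'.
have ab := precP gn0 g'n0 gg' gE g'E.
split; last by rewrite gE g'E; apply: interlaces_prodX.
have a_neg := neg _ _ g0 gE a0; have b_neg := neg _ _ g'0 g'E b0.
have le_a : (2 * size a <= n)%N.
  have [+ _] := exp_f; rewrite {1}gE size_scale_prodX ?gt_eqF // ltnS.
  by move: (size a); clear; lia.
have le_b : (2 * size b <= n.+1)%N.
  have [+ _] := exp_f'; rewrite {1}g'E size_scale_prodX ?gt_eqF // ltnS.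
  by move: (size b); clear; lia.
have [c c0 exp_a] := gamma_expansion_prodX a_neg le_a.
have [e e0 exp_b] := gamma_expansion_prodX b_neg le_b.
have same m h h' k : gamma_expansion m h k -> gamma_expansion m h' k -> h = h'.
  by move=> [_ ->] [_ ->].
have := gamma_expansionZ (lead_coef g) exp_a; rewrite -gE => /(same _ _ _ _ exp_f) ->.
have := gamma_expansionZ (lead_coef g') exp_b; rewrite -g'E => /(same _ _ _ _ exp_f') ->.
rewrite !scalerA; apply: interlaces_prodX; rewrite ?mulr_gt0 //.
exact: interlaced_gamma.
Qed.
End GammaTransfer.

(** * The Chow polynomial as a sum over the elements of the poset *)

Section RankFacts.
Context {d : Order.disp_t} {T : finTBPOrderType d}.
Hypothesis gT : graded T.
Implicit Types s t u v w : T.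

Lemma rk_mono s t : (s < t)%O -> (rk s < rk t)%N.
Proof. by case: gT => rho rhoP; rewrite !(rankE rhoP); apply: rank_function_mono. Qed.

Lemma rk_mono_le s t : (s <= t)%O -> (rk s <= rk t)%N.
Proof. by rewrite le_eqVlt => /predU1P[-> // | /rk_mono/ltnW]. Qed.

Lemma rk_bot : rk (\bot%O : T) = 0%N.
Proof. by case: gT => rho rhoP; rewrite (rankE rhoP); case: rhoP. Qed.

Lemma rk_covers s t : covers s t -> rk t = (rk s).+1.
Proof. by case: gT => rho rhoP; rewrite !(rankE rhoP); case: rhoP => _; apply. Qed.

Lemma rk_le_rank s : (rk s <= rank T)%N.
Proof. exact/rk_mono_le/lex1. Qed.

Lemma rk_lt_rank s : (rk s < rank T)%N = (s != \top%O).
Proof.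
apply/idP/idP => [|s_neq]; first by apply: contraTneq => ->; rewrite ltnn.
by apply: rk_mono; rewrite lt_neqAle s_neq lex1.
Qed.

Lemma rk_inj_le s t : (s <= t)%O -> rk s = rk t -> s = t.
Proof. by rewrite le_eqVlt => /predU1P[// | /rk_mono]; lia. Qed.

End RankFacts.

Section ChowRecursion.
Variable R : realType.
Context {d : Order.disp_t} {T : finTBPOrderType d}.
Implicit Types s t u v w : T.
Local Notation H := (@chow_above R d T).

Lemma mobius_sum s u : (s <= u)%O ->
  \sum_(w | (s <= w <= u)%O) mobius s w = (s == u)%:R :> int.
Proof.
move=> le_su; rewrite (bigD1 u) /= ?le_su ?lexx // mobiusE.
have -> : \sum_(w | (s <= w <= u)%O && (w != u)) mobius s w =
          \sum_(w | (s <= w < u)%O) mobius s w :> int.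
  by apply: eq_bigl => w; rewrite -andbA [(w < u)%O]lt_neqAle [(w != u) && _]andbC.
case: eqVneq => [<- | _]; last by rewrite addNr.
by rewrite big1 ?addr0 // => w /andP[/le_lt_trans le_sw /le_sw]; rewrite ltxx.
Qed.

Lemma mobius_refl s : mobius s s = 1.
Proof. by rewrite mobiusE eqxx. Qed.

Lemma chi_bar_mul s t : (s < t)%O -> ('X - 1) * chi_bar R s t = chi R s t.
Proof.
move=> lt_st; rewrite mulrC /chi_bar divpK //.
rewrite -[X in 'X - X]polyC1 dvdp_XsubCl rootE /chi horner_sum.
under eq_bigr => w _ do rewrite hornerZ hornerXn expr1n mulr1.
by rewrite -[X in X == 0]rmorph_sum mobius_sum ?ltW // (lt_eqF lt_st).
Qed.

Lemma sum_geD1 (V : zmodType) (F : T -> V) s :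
  \sum_(t | (s <= t)%O) F t = F s + \sum_(t | (s < t)%O) F t.
Proof.
rewrite (bigD1 s) //=; congr (_ + _); apply: eq_bigl => t.
by rewrite lt_neqAle eq_sym andbC.
Qed.

(** The defining recursion times ['X - 1]: including the term [t = s], with
    [chi s s = 1], turns the left factor ['X - 1] into ['X]. *)
Lemma chow_chi s : \sum_(t | (s <= t)%O) chi R s t * H t =
  'X * H s - (s == \top%O)%:R * ('X - 1).
Proof.
have chi_refl : chi R s s = 1.
  rewrite /chi (big_pred1 s) => [|w]; last by rewrite -eq_le eq_sym.
  by rewrite mobius_refl subnn expr0 scale1r.
rewrite sum_geD1 chi_refl mul1r.
have sumE : \sum_(t | (s < t)%O) chi R s t * H t =
    ('X - 1) * \sum_(t | (s < t)%O) chi_bar R s t * H t.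
  by rewrite mulr_sumr; apply: eq_bigr => t lt_st; rewrite mulrA chi_bar_mul.
rewrite sumE; case: (eqVneq s \top%O) => [-> | s_neq].
  rewrite big_pred0 => [|t]; last by rewrite lt_leAnge lex1 andbF.
  have -> : H \top%O = 1 by rewrite chow_aboveE eqxx.
  by rewrite mulr1n; ring.
have HE : \sum_(t | (s < t)%O) chi_bar R s t * H t = H s.
  by rewrite [RHS]chow_aboveE (negPf s_neq).
by rewrite HE mulr0n; ring.
Qed.

(** The Moebius matrix is unitriangular. *)
Lemma mobius_injective (F G : T -> {poly R}) :
    (forall s, \sum_(w | (s <= w)%O) (mobius s w)%:~R *: F w =
               \sum_(w | (s <= w)%O) (mobius s w)%:~R *: G w) ->
  F =1 G.
Proof.
move=> eqFG s; have [n] := ubnP #|[set u | (s < u)%O]|.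
elim: n s => // n IHn s /ltnSE le_n; have := eqFG s.
rewrite !sum_geD1 mobius_refl !scale1r.
rewrite (eq_bigr (fun w => (mobius s w)%:~R *: G w)) => [/addIr // | w lt_sw].
by rewrite IHn // (leq_trans _ le_n) // above_card.
Qed.

(** Writing [chi] as a Moebius sum shows that both sides have the same Moebius
    transform, by [chow_chi]. *)
Lemma chow_mobius s : graded T ->
  \sum_(t | (s <= t)%O) 'X^(rk t - rk s) * H t =
  'X * (\sum_(t | (s <= t)%O) H t) - ('X - 1).
Proof.
move=> gT; pose K v := \sum_(t | (v <= t)%O) 'X^(rk t - rk v) * H t.
pose K' v := 'X * (\sum_(t | (v <= t)%O) H t) - ('X - 1).
apply: (mobius_injective (F := K) (G := K')) => {}s.
have swap (F : T -> T -> {poly R}) :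
    \sum_(w | (s <= w)%O) \sum_(t | (w <= t)%O) F w t =
    \sum_(t | (s <= t)%O) \sum_(w | (s <= w <= t)%O) F w t.
  rewrite (exchange_big_dep (>= s)%O) => [|w t /= le_sw]; last exact: le_trans.
  by apply: eq_bigr => t _; apply: eq_bigl => w.
transitivity (\sum_(t | (s <= t)%O) chi R s t * H t).
  under eq_bigr => w _ do rewrite scaler_sumr.
  rewrite swap; apply: eq_bigr => t _; rewrite mulr_suml.
  by apply: eq_bigr => w _; rewrite scalerAl.
rewrite chow_chi /K'.
have inner t (p : {poly R}) : (s <= t)%O ->
    \sum_(w | (s <= w <= t)%O) (mobius s w)%:~R *: p = (s == t)%:R *: p.
  move=> le_st; rewrite -scaler_suml -[X in X *: _]rmorph_sum mobius_sum //.
  by case: (s == t).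
transitivity (\sum_(w | (s <= w)%O) \sum_(t | (w <= t)%O) (mobius s w)%:~R *: ('X * H t)
   - \sum_(w | (s <= w <= \top)%O) (mobius s w)%:~R *: ('X - 1 : {poly R})); last first.
  rewrite [X in _ - X = _](eq_bigl (fun w => (s <= w)%O)) => [|w]; last first.
    by rewrite lex1 andbT.
  rewrite -sumrB; apply: eq_bigr => w _.
  by rewrite -scaler_sumr -scalerBr -mulr_sumr.
rewrite swap (eq_bigr _ (fun t => inner t ('X * H t))) inner ?lex1 //.
rewrite sum_geD1 eqxx scale1r big1 ?addr0 => [|t lt_st]; last first.
  by rewrite (lt_eqF lt_st) scale0r.
by rewrite -mul_polyC; case: eqP.
Qed.

Definition qnum n : {poly R} := \sum_(i < n) 'X^i.

Lemma qnumE n : ('X - 1) * qnum n = 'X^n - 1.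
Proof. by rewrite subrX1. Qed.

Lemma qnumS n : qnum n.+1 = 1 + 'X * qnum n.
Proof.
rewrite /qnum big_ord_recl expr0 mulr_sumr; congr (_ + _).
by apply: eq_bigr => i _; rewrite -exprS.
Qed.

(** The case [j = 0] is the Chow polynomial of [s, \top].  In the augmented
    polynomial the term x^r of an element of rank r joins x + ... + x^(r-1), which
    gives the case [j = 1]. *)
Definition stretched_chow j s : {poly R} :=
  1 + \sum_(w | (s < w)%O) 'X * qnum (rk w - rk s + j).-1 * H w.

Lemma chow_above_stretched s : graded T -> H s = stretched_chow 0 s.
Proof.
move=> gT; have := chow_mobius s gT; rewrite !sum_geD1 subnn expr0 mul1r mulrDr => E.
apply: (mulfI (monic_neq0 (monicXsubC (1 : R)))); rewrite polyC1.
rewrite /stretched_chow mulrDr mulr1 mulr_sumr.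
have -> : \sum_(t | (s < t)%O) ('X - 1) * ('X * qnum (rk t - rk s + 0).-1 * H t) =
  \sum_(t | (s < t)%O) 'X^(rk t - rk s) * H t - 'X * \sum_(t | (s < t)%O) H t.
  rewrite mulr_sumr -sumrB; apply: eq_bigr => t lt_st.
  rewrite addn0 mulrA mulrCA qnumE mulrBr mulr1 -exprS prednK ?subn_gt0 ?rk_mono //.
  by rewrite mulrBl.
move: E; set A := \sum_(t | _) _; set B := \sum_(t | _) H t => E.
have -> : A = 'X * H s + 'X * B - ('X - 1) - H s by rewrite -E addrAC subrr add0r.
by move: (H s) B {E} => h b; ring.
Qed.

Lemma aug_chow_stretched : graded T -> aug_chow R T = stretched_chow 1 \bot%O.
Proof.
move=> gT; rewrite /aug_chow.
transitivity (\sum_(s : T | (\bot <= s)%O) 'X^(rk s) * H s).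
  by apply: eq_bigl => s; rewrite le0x.
rewrite sum_geD1 (rk_bot gT) expr0 mul1r chow_above_stretched // /stretched_chow -addrA.
congr (_ + _); rewrite -big_split; apply: eq_bigr => s lt0s.
rewrite rk_bot // subn0 addn0 addn1 /= -mulrDl; congr (_ * _).
have := rk_mono gT lt0s; rewrite rk_bot //; case: (rk s) => // n _ /=.
rewrite exprS -mulrDr; congr (_ * _).
by rewrite /qnum big_ord_recr.
Qed.

End ChowRecursion.

(** * Flag numbers and the gamma expansion *)

Section Flags.
Context {d : Order.disp_t} {T : finTBPOrderType d}.
Implicit Types s t u v w : T.

(** Both ends of the chains are arguments because duality exchanges them. *)
Fixpoint nchains s t (rs : seq nat) : nat :=
  if rs is r :: rs' then (\sum_(w : T | (s < w)%O && (rk w == r)) nchains w t rs')%N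
  else (s < t)%O.

Definition flag_count (B : bitseq) : nat :=
  nchains \bot%O \top%O (mask B (iota 1 (size B))).

End Flags.

Section GapSums.
Variable R : realType.
Implicit Types (B S : bitseq) (a b : bitseq -> nat).
Local Notation qnum := (qnum R).

(** The linear functional expressing a Chow polynomial through the flag numbers
    [a]: reading the bits of the ranks in order, [j] is the current gap, minus
    one, since the last chosen rank. *)
Fixpoint gap_sum m a j : {poly R} :=
  if m is m'.+1 then
    'X * qnum j * gap_sum m' (a \o cons true) 0 + gap_sum m' (a \o cons false) j.+1
  else qnum j.+1 * (a [::])%:R.

Lemma eq_gap_sum m a b j : (forall B, size B = m -> a B = b B) ->
  gap_sum m a j = gap_sum m b j.
Proof.
elim: m a b j => [|m IHm] a b j ab /=; first by rewrite ab.
by congr (_ * _ + _); apply: IHm => B szB; apply: ab; rewrite /= szB.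
Qed.

Lemma gap_sum_sum (I : Type) (r : seq I) (P : pred I) m (a : I -> bitseq -> nat) j :
  gap_sum m (fun B => \sum_(i <- r | P i) a i B)%N j =
  \sum_(i <- r | P i) gap_sum m (a i) j.
Proof.
elim: m a j => [|m IHm] a j /=; first by rewrite natr_sum mulr_sumr.
rewrite (IHm (fun i => a i \o cons true)) (IHm (fun i => a i \o cons false)).
by rewrite mulr_sumr -big_split.
Qed.

Lemma gap_sumD m a b j :
  gap_sum m (fun B => a B + b B)%N j = gap_sum m a j + gap_sum m b j.
Proof.
elim: m a b j => [|m IHm] a b j /=; first by rewrite natrD mulrDr.
rewrite (IHm (a \o cons true) (b \o cons true)).
by rewrite (IHm (a \o cons false) (b \o cons false)) mulrDr addrACA.
Qed.

(** The total weight, in [gap_sum], of the rank sets containing [S]. *)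
Fixpoint flag_weight S j : {poly R} :=
  if S is b :: S' then
    'X * qnum j * flag_weight S' 0 + (if b then 0 else flag_weight S' j.+1)
  else qnum j.+1.

Lemma gap_sum_subsum m (beta : bitseq -> nat) j :
  gap_sum m (subsum beta) j = bitsum m (fun S => (beta S)%:R * flag_weight S j).
Proof.
elim: m beta j => [|m IHm] beta j; first by rewrite /= mulrC.
rewrite bitsumS /=.
rewrite (@eq_gap_sum m (subsum beta \o cons true)
  (fun B => subsum (beta \o cons true) B + subsum (beta \o cons false) B)%N) //.
rewrite (@eq_gap_sum m (subsum beta \o cons false) (subsum (beta \o cons false))); last first.
  by move=> B _ /=; rewrite add0r.
rewrite gap_sumD mulrDr !IHm -addrA /bitsum !mulr_subsum.
congr (_ + _); last rewrite -subsumD; apply: eq_subsum => S _ /=.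
  by rewrite addr0 mulrCA.
by rewrite mulrDr mulrCA.
Qed.

Lemma qnum_rec j : qnum j.+2 = (1 + 'X) * qnum j.+1 - 'X * qnum j.
Proof. by rewrite !qnumS; ring. Qed.

Lemma flag_weight_rec S j :
  flag_weight S j.+2 = (1 + 'X) * flag_weight S j.+1 - 'X * flag_weight S j.
Proof.
elim: S j => [|b S IHS] j /=; first exact: qnum_rec.
rewrite qnum_rec; case: b; last rewrite IHS; ring.
Qed.

(** As a function of the initial gap [j] the weight is a combination of 1 and
    x^j ([flag_weight_rec]), so the recursion on [S] only involves the gaps 0 and
    1, and it becomes that of the monomials x^i (1 + x)^(d - 2 i). *)
Lemma flag_weight_expansion S :
  gamma_expansion (size S) (flag_weight S 0) (stable_mon R false S) /\
  gamma_expansion (size S).+1 (flag_weight S 1) (stable_mon R true S).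
Proof.
have q0 : qnum 0 = 0 by rewrite /qnum big_ord0.
have q1 : qnum 1 = 1 by rewrite qnumS q0 mulr0 addr0.
elim: S => [|b S [IH0 IH1]] /=.
  have e0 : gamma_expansion 0 (1 : {poly R}) 1.
    by split; rewrite ?size_poly1 // big_ord1 coefC expr0 mulr1 scale1r.
  rewrite (qnumS _ 1) q1 mulr1; split=> //.
  by have := gamma_expansion_mul1X e0; rewrite mulr1.
rewrite q0 q1 mulr0 mul0r add0r mulr1; case: b.
  rewrite !stable_mon_true addr0; split; first exact: gamma_expansion0.
  exact: gamma_expansion_mulX.
rewrite !stable_mon_false; split=> //.
by rewrite flag_weight_rec addrC subrK; apply: gamma_expansion_mul1X.
Qed.

Section Poset.
Context {d : Order.disp_t} {T : finTBPOrderType d}.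
Hypothesis gT : graded T.
Implicit Types s t u v w : T.
Local Notation H := (@chow_above R d T).

Lemma gap_sum_chains m s i j : (rk s + i + m).+1 = rank T ->
  gap_sum m (fun B => nchains s \top%O (mask B (iota (rk s + i).+1 m))) (i + j) =
  1 + \sum_(w | (s < w)%O && (rk s + i < rk w)%N)
        'X * qnum (rk w - rk s + j).-1 * H w.
Proof.
elim: m s i j => [|m IHm] s i j rk_s.
  have lt_s : (s < \top)%O.
    by rewrite lt_neqAle lex1 andbT -rk_lt_rank // -rk_s addn0 ltnS leq_addr.
  rewrite (big_pred1 \top%O) => [|w]; last first.
    apply/andP/eqP => [[_ lt_w] | ->]; last by rewrite lt_s -/(rank T) -rk_s addn0.
    apply/eqP; apply: contraLR lt_w; rewrite -rk_lt_rank // -rk_s addn0 => lt_w.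
    by rewrite -leqNgt -ltnS.
  rewrite [H _]chow_aboveE eqxx mulr1 /= lt_s mulr1 qnumS -/(rank T) -rk_s addn0.
  by rewrite -addnS addKn addSn.
rewrite /= -[_ \o cons true]/(fun B => \sum_(w : T | (s < w)%O && (rk w == (rk s + i).+1))
     nchains w \top%O (mask B (iota (rk s + i).+2 m)))%N gap_sum_sum.
rewrite -[_ \o cons false]/(fun B => nchains s \top%O (mask B (iota (rk s + i).+2 m))).
have := IHm s i.+1 j; rewrite addnS => ->; last by rewrite -rk_s addnS addSn.
rewrite addrCA; congr (_ + _).
rewrite [RHS](bigID (fun w => rk w == (rk s + i).+1)) /=; congr (_ + _).
  rewrite mulr_sumr; apply: eq_big => [w | w /andP[lt_sw /eqP rk_w]].
    by case: eqP => [->|_]; rewrite ?andbF // ltnSn !andbT.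
  rewrite rk_w (_ : ((rk s + i).+1 - rk s + j).-1 = i + j)%N; last by rewrite -addnS addKn.
  congr (_ * _).
  have := IHm w 0 0; rewrite !addn0 rk_w => E.
  apply: (eq_trans (E _)); first by rewrite -rk_s addnS.
  rewrite chow_above_stretched // /stretched_chow; congr (_ + _).
  rewrite -rk_w; apply: eq_bigl => v; by case: (boolP (w < v)%O) => //= /(rk_mono gT) ->.
apply: eq_bigl => w; rewrite -andbA; congr (_ && _).
by rewrite [RHS]andbC ltn_neqAle eq_sym.
Qed.

Theorem chow_gamma_expansion m (beta : bitseq -> nat) : rank T = m.+1 ->
    (forall B, size B = m -> @flag_count d T B = subsum beta B) ->
  gamma_expansion m (chow R T) (stable_sum R false m beta) /\
  gamma_expansion m.+1 (aug_chow R T) (stable_sum R true m beta).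
Proof.
move=> rkT flagE.
have chowE j : stretched_chow R j (\bot%O : T) =
    bitsum m (fun S => (beta S)%:R * flag_weight S j).
  rewrite -gap_sum_subsum.
  have := @gap_sum_chains m \bot%O 0 j; rewrite rk_bot // !add0n rkT => /(_ erefl) E.
  have -> : gap_sum m (subsum beta) j =
      gap_sum m (fun B => nchains (\bot%O : T) \top%O (mask B (iota 1 m))) j.
    by apply: eq_gap_sum => B szB; rewrite -flagE // /flag_count szB.
  rewrite E /stretched_chow; congr (_ + _); apply: eq_big => [w|w _].
    by case: (boolP (_ < w)%O) => //= /(rk_mono gT); rewrite rk_bot.
  by rewrite rk_bot.
rewrite /chow chow_above_stretched // aug_chow_stretched // !chowE.
have sum_exp k B (F G : bitseq -> {poly R}) :
    (forall S, size S = size B -> gamma_expansion k (F S) (G S)) ->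
    gamma_expansion k (subsum F B) (subsum G B).
  elim: B F G => [|b B IHB] F G /= FG; first exact: FG.
  apply: gamma_expansionD; last by apply: IHB => S szS; apply: FG; rewrite /= szS.
  case: b FG => FG; last exact: gamma_expansion0.
  by apply: IHB => S szS; apply: FG; rewrite /= szS.
split; apply: sum_exp => S; rewrite size_nseq => <-; rewrite mulr_natl -scaler_nat;
  by apply: gamma_expansionZ; case: (flag_weight_expansion S).
Qed.

End Poset.
End GapSums.

Local Close Scope ring_scope.

(** * Truncation and duality *)

Section Truncation.
Context {d : Order.disp_t} {T : finTBPOrderType d}.
Hypotheses (gT : graded T) (rank2 : (2 <= rank T)%N).
Implicit Types (s t u v w : T) (x y z : trunc T).

Lemma trunc_lt x y : (x < y)%O = (trunc_val x < trunc_val y)%O.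
Proof. by []. Qed.

Lemma trunc_rk_lt x : x != \top%O -> (rk (trunc_val x) < (rank T).-1)%N.
Proof.
move=> x_neq; case/or3P: (trunc_valP x) => [/eqP->|/eqP x_top|rk_neq].
- by rewrite rk_bot //; lia.
- by case/eqP: x_neq; apply: val_inj.
have : (rk (trunc_val x) < rank T)%N.
  by rewrite rk_lt_rank //; apply: contraNneq x_neq => x_top; apply/eqP/val_inj.
by move: rk_neq; clear; lia.
Qed.

Let rho x := if x == \top%O then (rank T).-1 else rk (trunc_val x).

Lemma trunc_rank_function : is_rank_function rho.
Proof.
split=> [|x y /andP[lt_xy /forallP no_mid]].
  rewrite /rho; case: eqP => [/(congr1 (fun x => rk (trunc_val x)))|_]; last exact: rk_bot.
  by rewrite /= (rk_bot gT) -/(rank T) => rk0; move: rank2; rewrite -rk0.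
have x_top : x != \top%O.
  apply: contraTneq lt_xy => ->; rewrite trunc_lt.
  by apply/negP => /lt_le_trans/(_ (lex1 _)); rewrite ltxx.
have lt_x := trunc_rk_lt x_top; rewrite trunc_lt in lt_xy.
have [v le_xv cov_vy] := lt_covers lt_xy.
(* The element just below y survives the truncation unless y is the top. *)
have [u] : exists2 u, (trunc_val x <= u < trunc_val y)%O & rk u = (rho y).-1.
  rewrite /rho; case: ifP => [/eqP y_top | y_top]; last first.
    exists v; first by rewrite le_xv; case/andP: cov_vy.
    by rewrite (rk_covers gT cov_vy).
  have rk_v : rk v = (rank T).-1.
    by have := rk_covers gT cov_vy; rewrite y_top /= /rank => ->.
  have lt_xv : (trunc_val x < v)%O.
    by rewrite lt_neqAle le_xv andbT; apply: contraTneq lt_x => ->; rewrite rk_v ltnn.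
  have [u le_xu cov_uv] := lt_covers lt_xv; exists u.
    rewrite le_xu (@lt_trans _ _ v) //; first by case/andP: cov_uv.
    by case/andP: cov_vy.
  by rewrite -rk_v (rk_covers gT cov_uv).
case/andP=> le_xu lt_uy rk_u.
have rho_gt0 : (0 < rho y)%N.
  rewrite /rho; case: ifP => _; first by move: rank2; lia.
  by have := rk_mono gT lt_xy; lia.
have rho_le : (rho y <= (rank T).-1)%N.
  by rewrite /rho; case: ifP => // /negbT/trunc_rk_lt/ltnW.
have uP : truncP u by rewrite /truncP rk_u; apply/orP; right; apply/orP; right; lia.
have := no_mid (Trunc uP); rewrite !trunc_lt /= lt_uy andbT.
rewrite lt_neqAle le_xu andbT negbK => /eqP xu.
rewrite {2}/rho (negPf x_top) xu rk_u; lia.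
Qed.

Lemma trunc_graded : graded (trunc T).
Proof. by exists rho; apply: trunc_rank_function. Qed.

Lemma rk_trunc x : x != \top%O -> rk x = rk (trunc_val x).
Proof. by move=> x_top; rewrite (rankE trunc_rank_function) /rho (negPf x_top). Qed.

Lemma rank_trunc : rank (trunc T) = (rank T).-1.
Proof. by rewrite /rank (rankE trunc_rank_function) /rho eqxx. Qed.

Lemma nchains_trunc x rs : all (fun r => r < (rank T).-1)%N rs ->
  nchains x \top%O rs = nchains (trunc_val x) \top%O rs.
Proof.
elim: rs x => //= r rs IHrs x /andP[lt_r lt_rs].
rewrite [RHS](reindex_omap (@trunc_val d T) insub) => [|w /andP[_ /eqP rk_w]]; last first.
  by rewrite insubT // /truncP rk_w ltn_eqF ?orbT.
apply: eq_big => [w | w _]; last exact: IHrs.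
rewrite (valK w) eqxx andbT trunc_lt; congr (_ && _).
have [-> | w_top] := eqVneq w \top%O; last by rewrite rk_trunc.
rewrite -/(rank (trunc T)) rank_trunc /= -/(rank T).
by move: lt_r rank2; clear; lia.
Qed.

Lemma flag_count_trunc B : size B = (rank T).-2 ->
  flag_count (T := trunc T) B = flag_count (T := T) (rcons B false).
Proof.
move=> szB; rewrite /flag_count size_rcons nchains_trunc.
  by rewrite -cats1 -(addn1 (size B)) iotaD mask_cat ?size_iota // cats0.
apply/allP => r /mem_mask; rewrite mem_iota szB; lia.
Qed.

End Truncation.

Section Duality.
Context {d : Order.disp_t} {T : finTBPOrderType d}.
Hypothesis gT : graded T.
Implicit Types (s t u v w : T).

Lemma covers_dual s t : covers (s : T^d) (t : T^d) = covers t s.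
Proof.
by rewrite /covers; congr (_ && _); apply: eq_forallb => u; rewrite andbC.
Qed.

Lemma dual_rank_function :
  is_rank_function (fun s : T^d => rank T - rk (s : T))%N.
Proof.
split=> [|s t]; first exact: subnn.
rewrite covers_dual => cov; have := rk_covers gT cov.
by have := rk_le_rank gT s; lia.
Qed.

Lemma dual_graded : graded T^d.
Proof. by eexists; apply: dual_rank_function. Qed.

Lemma rk_dual s : rk (s : T^d) = (rank T - rk s)%N.
Proof. by rewrite (rankE dual_rank_function). Qed.

Lemma rank_dual : rank T^d = rank T.
Proof. by rewrite {1}/rank rk_dual rk_bot ?subn0. Qed.

Lemma nchains_rcons s t rs r : nchains s t (rcons rs r) =
  (\sum_(w : T | (w < t)%O && (rk w == r)) nchains s w rs)%N.
Proof.
elim: rs s => [|r' rs IHrs] s /=.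
  rewrite [LHS]big_mkcond [RHS]big_mkcond; apply: eq_bigr => w _.
  by case: (s < w)%O; case: (w < t)%O; case: eqP.
under eq_bigr => w _ do rewrite IHrs.
exact: exchange_big.
Qed.

Lemma nchains_dual s t rs : all (fun r => r <= rank T)%N rs ->
  nchains (t : T^d) (s : T^d) rs = nchains s t (rev (map (subn (rank T)) rs)).
Proof.
elim: rs t => //= r rs IHrs t /andP[le_r le_rs].
rewrite rev_cons nchains_rcons; apply: eq_big => w; last by move=> _; apply: IHrs.
congr (_ && _); rewrite rk_dual; have := rk_le_rank gT w.
by move=> le_w; apply/eqP/eqP; move: le_w le_r; clear; lia.
Qed.

Lemma flag_count_dual B : (size B).+1 = rank T ->
  flag_count (T := T^d) B = flag_count (T := T) (rev B).
Proof.
move=> szB; rewrite /flag_count size_rev; set k := size B in szB *.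
rewrite [LHS]nchains_dual.
  rewrite map_mask rev_mask; last by rewrite size_map size_iota.
  congr (nchains _ _ (mask _ _)); apply: (@eq_from_nth _ 0%N) => [|i].
    by rewrite size_rev size_map.
  rewrite size_rev size_map size_iota => lt_ik.
  rewrite nth_rev size_map size_iota // (nth_map 0%N) ?size_iota; last by lia.
  by rewrite !nth_iota //; lia.
apply/allP => r /mem_mask; rewrite mem_iota -/k; lia.
Qed.

End Duality.

(** * Descents of labeled maximal chains *)

Lemma index_count (dL : Order.disp_t) (L : orderType dL) (x y : L) (l : seq L) :
  sorted <%O l -> x \in l -> (index x l < count (< y)%O l)%N = (x < y)%O.
Proof.
elim: l => //= a l IHl path_l; rewrite inE eq_sym => xl.
have /allP gt_a := order_path_min lt_trans path_l.
case: (ltP a y) => [lt_ay | le_ya].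
  case: eqVneq xl => [<- _ | _ /= xl]; first by rewrite lt_ay.
  by rewrite add1n ltnS IHl ?(path_sorted path_l).
have -> : count (< y)%O l = 0%N.
  apply/eqP; rewrite -leqn0 leqNgt -has_count; apply/hasP => -[z /gt_a /= lt_az].
  by move/(lt_trans lt_az); rewrite ltNge le_ya.
rewrite ltn0; apply/esym/negbTE; rewrite -leNgt.
by case: eqVneq xl => [<- // | _ /gt_a /ltW]; apply: le_trans.
Qed.

Section DescentCounts.
Context {d : Order.disp_t} {T : finTBPOrderType d}.
Context {dL : Order.disp_t} {L : orderType dL}.
Variable lam : T -> T -> L.
Hypothesis gT : graded T.
Implicit Types (s t u v w : T) (c : seq T) (S B : bitseq).

Lemma path_covers_le s c : path covers s c -> (s <= last s c)%O.
Proof.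
elim: c s => [|t c IHc] s //= /andP[/andP[lt_st _] /IHc].
exact/le_trans/ltW.
Qed.

Lemma covers_lt s t : covers s t -> (s < t)%O.
Proof. by case/andP. Qed.

(** All that is needed of an EL-labeling: [nx s w] is the second element of the
    increasing maximal chain from [s] to [w].  By uniqueness, this chain passes
    through [t] exactly when the one from [t] to [w] remains increasing after
    [s] is put in front. *)
Lemma EL_next : EL_labeling lam -> exists nx : T -> T -> T,
  (forall s w, (s < w)%O -> covers s (nx s w) && (nx s w <= w)%O) /\
  (forall s t w, covers s t -> (t < w)%O ->
     (nx s w == t) = (lam s t <= lam t (nx t w))%O).
Proof.
move=> EL.
have [ch chP] : exists ch : T -> T -> seq T, forall s w, (s < w)%O ->
    [/\ maximal_chain s w (ch s w), sorted <=%O (chain_labels lam s (ch s w))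
      & forall c, maximal_chain s w c ->
          sorted <=%O (chain_labels lam s c) -> c = ch s w].
  have /boolp.choice[ch chP] : forall sw : T * T, exists c : seq T, (sw.1 < sw.2)%O ->
      [/\ maximal_chain sw.1 sw.2 c, sorted <=%O (chain_labels lam sw.1 c)
        & forall c', maximal_chain sw.1 sw.2 c' ->
            sorted <=%O (chain_labels lam sw.1 c') -> c' = c].
    move=> [s w] /=; case: (boolP (s < w)%O) => [lt_sw | _]; last by exists [::].
    by have [c [? ? ? _]] := EL s w (ltW lt_sw); exists c.
  by exists (fun s w => ch (s, w)) => s w; apply: chP (s, w).
have chE s w : (s < w)%O -> exists t c, ch s w = t :: c.
  move=> lt_sw; case: (chP s w lt_sw) => /andP[_ /eqP].
  case: (ch s w) => [/= sw | t c _ _ _]; last by exists t, c.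
  by rewrite sw ltxx in lt_sw.
exists (fun s w => head w (ch s w)); split=> [s w lt_sw | s t w cov_st lt_tw].
  have [/andP[p /eqP lst] _ _] := chP s w lt_sw; have [t [c cE]] := chE s w lt_sw.
  by move: p lst; rewrite cE /= => /andP[-> /path_covers_le le_t] <-.
have lt_sw := lt_trans (covers_lt cov_st) lt_tw.
have [/andP[ps ls] ss us] := chP s w lt_sw; have [s' [cs csE]] := chE s w lt_sw.
have [/andP[pt lt] st ut] := chP t w lt_tw; have [t' [ct ctE]] := chE t w lt_tw.
rewrite csE ctE /=; apply/eqP/idP => [hd | le_lam].
  rewrite {}hd in csE.
  have csE' : cs = ch t w.
    apply: ut; first by move: ps ls; rewrite csE /maximal_chain /= => /andP[_ ->] ->.
    by move: ss; rewrite csE /= => /path_sorted.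
  by move: ss; rewrite csE csE' ctE /= => /andP[].
suff : t :: ch t w = ch s w by rewrite csE => -[].
apply: us; first by rewrite /maximal_chain /= cov_st pt.
by move: st; rewrite ctE /= le_lam.
Qed.

(** Chains from [s] to the top whose second element is [t]; the bits of [S] tell
    at which of the elements from [t] on the labels descend. *)
Fixpoint chains_des s t S : nat :=
  if S is b :: S' then
    (\sum_(u | covers t u && ((lam t u < lam s t)%O == b)) chains_des t u S')%N
  else 1%N.

Definition descent_count S : nat := (\sum_(t | covers \bot%O t) chains_des \bot%O t S)%N.

Section Next.
Variable nx : T -> T -> T.
Hypothesis nxP : forall s w, (s < w)%O -> covers s (nx s w) && (nx s w <= w)%O.
Hypothesis nx_lam : forall s t w, covers s t -> (t < w)%O ->
  (nx s w == t) = (lam s t <= lam t (nx t w))%O.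

(** Chains with prescribed ranks, classified by the first step of the
    increasing chain from [s] to their first element. *)
Definition nchains_via s t (rs : seq nat) : nat :=
  if rs is r :: rs' then
    (\sum_(w | [&& (t <= w)%O, rk w == r & nx s w == t]) nchains w \top%O rs')%N
  else nx s \top%O == t.

Lemma nx_covers s w : covers s w -> nx s w = w.
Proof.
move=> cov_sw; have /andP[cov_nx le_nx] := nxP (covers_lt cov_sw).
apply/eqP; move: le_nx; rewrite le_eqVlt => /orP[// | lt_nx].
by case/andP: cov_sw => _ /forallP/(_ (nx s w)); rewrite (covers_lt cov_nx) lt_nx.
Qed.

Lemma sum_nchains_via t rs (P : pred T) : (t < \top)%O ->
  (\sum_(u | covers t u && P u) nchains_via t u rs =
   if rs is r :: rs' then
     \sum_(w | [&& (t < w)%O, rk w == r & P (nx t w)]) nchains w \top%O rs'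
   else P (nx t \top%O) : nat)%N.
Proof.
move=> lt_t; case: rs => [|r rs] /=.
  have /andP[cov_nx _] := nxP lt_t.
  case: (boolP (P _)) => [Pnx | nPnx].
    rewrite (bigD1 (nx t \top%O)) /= ?eqxx ?cov_nx // big1 // => u /andP[_].
    by rewrite eq_sym => /negPf ->.
  by rewrite big1 // => u /andP[_ Pu]; case: eqP nPnx => // ->; rewrite Pu.
rewrite [RHS](partition_big (nx t) (fun u => covers t u && P u)) /=; last first.
  by move=> w /and3P[/nxP/andP[-> _] _ ->].
apply: eq_bigr => u /andP[cov_tu Pu]; apply: eq_bigl => w.
case: (eqVneq (nx t w) u) => [nx_u | _]; last by rewrite !andbF.
rewrite nx_u Pu !andbT; congr (_ && _); apply/idP/idP => [le_uw | /nxP/andP[_]].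
  exact: lt_le_trans (covers_lt cov_tu) le_uw.
by rewrite nx_u.
Qed.

Lemma sum_nchains_via_all t rs : (t < \top)%O ->
  (\sum_(u | covers t u) nchains_via t u rs = nchains t \top%O rs)%N.
Proof.
move=> lt_t; have := sum_nchains_via rs predT lt_t.
under eq_bigl => u do rewrite andbT; move=> ->.
case: rs => [|r rs]; first by rewrite /= lt_t.
by apply: eq_bigl => w; rewrite andbT.
Qed.

(** A chain whose descents are confined to given ranks increases in between, so
    it is determined by its elements of these ranks. *)
Lemma subsum_chains_des s t B : covers s t -> (rk t + size B)%N = rank T ->
  subsum (chains_des s t) B = nchains_via s t (mask B (iota (rk t) (size B))).
Proof.
elim: B s t => [|b B IHB] s t cov_st.
  rewrite addn0 /= => rk_t; have t_top : t = \top%O.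
    by apply/eqP; rewrite -[_ == _]negbK -rk_lt_rank // rk_t ltnn.
  by rewrite t_top in cov_st *; rewrite nx_covers ?eqxx.
rewrite /= addnS -addSn => rk_t.
have lt_t : (t < \top)%O.
  by rewrite lt_neqAle lex1 andbT -rk_lt_rank // -rk_t ltn_addr.
have IH u : covers t u ->
    subsum (chains_des t u) B = nchains_via t u (mask B (iota (rk t).+1 (size B))).
  by move=> cov_tu; rewrite IHB ?(rk_covers gT cov_tu).
have sumE e : subsum (chains_des s t \o cons e) B =
    (\sum_(u | covers t u && ((lam t u < lam s t)%O == e))
       nchains_via t u (mask B (iota (rk t).+1 (size B))))%N.
  transitivity (\sum_(u | covers t u && ((lam t u < lam s t)%O == e))
      subsum (chains_des t u) B)%R.
    exact: subsum_sum.
  by apply: eq_bigr => u /andP[/IH].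
case: b; rewrite ?add0r !sumE /=.
  rewrite [RHS](big_pred1 t) => [|w]; last first.
    rewrite /=; case: (eqVneq w t) => [-> | w_t]; first by rewrite lexx nx_covers // !eqxx.
    apply/negbTE/negP => /and3P[le_tw /eqP rk_w _].
    by rewrite (rk_inj_le gT le_tw) ?eqxx in w_t.
  rewrite -sum_nchains_via_all //.
  rewrite [RHS](bigID (fun u => lam t u < lam s t)%O) /=.
  by congr (_ + _)%N; apply: eq_bigl => u; [rewrite eqb_id | rewrite eqbF_neg].
rewrite (sum_nchains_via _ (fun u => (lam t u < lam s t)%O == false)) //.
have ge_mask : all (fun r => rk t < r)%N (mask B (iota (rk t).+1 (size B))).
  by apply/allP => r /mem_mask; rewrite mem_iota => /andP[].
have nxE w : (t < w)%O -> ((lam t (nx t w) < lam s t)%O == false) = (nx s w == t).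
  by move=> lt_tw; rewrite eqbF_neg -leNgt nx_lam.
case: (mask _ _) ge_mask => [_|r rs /andP[lt_r _]] /=; first by rewrite nxE.
apply: eq_bigl => w; case: (eqVneq (rk w) r) => [rk_w | _]; rewrite ?andbF //=.
have -> : (t <= w)%O = (t < w)%O.
  by rewrite [RHS]lt_neqAle; case: eqVneq => // tw; rewrite -rk_w tw ltnn in lt_r.
by case: (boolP (t < w)%O) => //= /nxE.
Qed.

End Next.

Lemma flag_count_descents B : EL_labeling lam -> (size B).+1 = rank T ->
  flag_count (T := T) B = subsum descent_count B.
Proof.
move=> EL szB; have [nx [nxP nx_lam]] := EL_next EL.
have lt0 : (\bot < \top :> T)%O.
  by rewrite lt_neqAle lex1 andbT -rk_lt_rank // rk_bot // -szB.
rewrite /flag_count -(sum_nchains_via_all nxP) //.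
transitivity (\sum_(t | covers \bot%O t) subsum (chains_des \bot%O t) B)%R; last first.
  by symmetry; apply: subsum_sum.
apply: eq_bigr => t cov_t; have := rk_covers gT cov_t; rewrite rk_bot // => rk_t.
by rewrite (subsum_chains_des nxP nx_lam) ?rk_t.
Qed.

Section RankUniform.
Hypotheses (unif : rank_uniform lam) (mono : monotonic lam).

Let I := 'I_(#|T|.+1).
Let label_index s t : I := inord (index (lam s t) (labels_above lam s)).

(** The maxima select common values: all elements of rank [k] have the same
    widths, and [des] depends only on the rank and the index.  By monotonicity,
    taking the maximum over all smaller indices as well does not change its
    value, and makes it increasing beyond the existing labels, too.  Indices of
    labels are shifted so as to start at 0. *)
Definition level_width k (j : I) : nat := \max_(s : T | rk s == k) width lam s j.+1.

Definition level_des k (i : I) : nat :=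
  \max_(p : T * T | [&& covers p.1 p.2, rk p.1 == k & (Ind lam p.1 p.2 <= i.+1)%N])
    des lam p.1 p.2.

Definition level_rel k (i j : I) : bool := (j < level_des k i)%N.

Lemma level_rel_staircase k : staircase (fun i : I => i : nat) (level_rel k).
Proof.
move=> i i' j j' le_ii' le_j'j; rewrite /level_rel => /(leq_ltn_trans le_j'j).
move/leq_trans; apply; apply/bigmax_leqP => p /and3P[cov_p rk_p Ind_p].
apply: (@leq_bigmax_cond _ _ (fun p => des lam p.1 p.2) p).
by rewrite cov_p rk_p (leq_trans Ind_p).
Qed.

Lemma labels_above_mem s t : covers s t -> lam s t \in labels_above lam s.
Proof.
by move=> cov; rewrite mem_sort mem_undup; apply/imageP; exists t.
Qed.

Lemma label_indexE s t : covers s t -> (label_index s t).+1 = Ind lam s t.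
Proof.
move=> cov; rewrite inordK // ltnS ltnW //.
rewrite (leq_trans (_ : _ < size (labels_above lam s)))%N //.
  by rewrite index_mem labels_above_mem.
by rewrite size_sort (leq_trans (size_undup _)) // size_map -cardE max_card.
Qed.

Lemma level_widthE s j : level_width (rk s) j = width lam s j.+1.
Proof.
apply/eqP; rewrite eqn_leq; apply/andP; split; last exact: leq_bigmax_cond.
by apply/bigmax_leqP => s' /eqP rk_s'; rewrite (unif.1 _ _ rk_s').
Qed.

Lemma level_desE s t : covers s t -> level_des (rk s) (label_index s t) = des lam s t.
Proof.
move=> cov; apply/eqP; rewrite eqn_leq /level_des label_indexE //; apply/andP; split.
  apply/bigmax_leqP => p /and3P[cov_p /eqP rk_p le_p]; exact: mono le_p.
apply: (@leq_bigmax_cond _ _ (fun p => des lam p.1 p.2) (s, t)).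
by rewrite /= cov eqxx leqnn.
Qed.

Lemma level_relE s t u : covers s t -> covers t u ->
  level_rel (rk s) (label_index s t) (label_index t u) = (lam t u < lam s t)%O.
Proof.
move=> cov_st cov_tu; rewrite /level_rel level_desE // -ltnS label_indexE // ltnS.
apply: index_count; last exact: labels_above_mem.
by rewrite lt_sorted_uniq_le sort_uniq undup_uniq sort_sorted //; apply: le_total.
Qed.

Lemma sum_level t (Q : pred I) (F : I -> nat) :
  (\sum_(u | covers t u && Q (label_index t u)) F (label_index t u) =
   \sum_(j | Q j) level_width (rk t) j * F j)%N.
Proof.
rewrite (partition_big (label_index t) Q) => [|u /andP[] //]; apply: eq_bigr => j Qj.
rewrite (eq_bigr (fun=> F j)) => [|u /andP[_ /eqP->] //].
rewrite sum_nat_const level_widthE /width; congr (_ * _)%N; apply: eq_card => u.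
rewrite [RHS]inE [LHS]unfold_in; case: (boolP (covers t u)) => //= cov.
rewrite -label_indexE // eqSS; case: (eqVneq (label_index t u) j) => [->|neq].
  by rewrite Qj eqxx.
by rewrite andbF; apply/esym/negbTE.
Qed.

Lemma chains_des_paths s t S : covers s t ->
  chains_des s t S =
  paths_from level_width level_rel (fun=> 1%N) (rk s) (label_index s t) S.
Proof.
elim: S s t => //= b S IHS s t cov_st; rewrite -(rk_covers gT cov_st).
rewrite -(sum_level t (fun j => level_rel (rk s) (label_index s t) j == b)).
rewrite (rk_covers gT cov_st); apply: eq_big => [u | u /andP[cov_tu _]].
  by case: (boolP (covers t u)) => //= cov_tu; rewrite level_relE.
by rewrite IHS // (rk_covers gT cov_st).
Qed.

Lemma descent_count_paths S :
  descent_count S = path_count level_width level_rel (fun=> 1%N) S.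
Proof.
have := sum_level \bot%O predT
  (fun i => paths_from level_width level_rel (fun=> 1%N) 0 i S).
rewrite rk_bot // => E; apply: (eq_trans _ E).
apply: eq_big => [t | t cov_t]; first by rewrite andbT.
by rewrite (chains_des_paths S cov_t) rk_bot.
Qed.

End RankUniform.
End DescentCounts.

(** * Interlacing for UMEL-shellable posets *)

Theorem theorem7p4 (R : realType) (d : Order.disp_t) (P : finTBPOrderType d)
    (P_graded : graded P) (P_rank : (2 <= rank P)%N) (P_UMEL : UMEL_shellable P) :
  ([/\ chow R (trunc P) ≼ chow R P,
       chow R (trunc P) ≼ aug_chow R (trunc P),
       chow R P ≼ aug_chow R P
     & aug_chow R (trunc P) ≼ aug_chow R P] /\
   [/\ gamma_chow R (trunc P) ≼ gamma_chow R P,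
       gamma_chow R (trunc P) ≼ gamma_aug_chow R (trunc P),
       gamma_chow R P ≼ gamma_aug_chow R P
     & gamma_aug_chow R (trunc P) ≼ gamma_aug_chow R P]) /\
  ([/\ chow R (trunc P) ≼ chow R P,
       chow R (trunc P) ≼ chow R P^d,
       chow R P ≼ aug_chow R P^d
     & chow R P^d ≼ aug_chow R P^d] /\
   [/\ gamma_chow R (trunc P) ≼ gamma_chow R P,
       gamma_chow R (trunc P) ≼ gamma_chow R P^d,
       gamma_chow R P ≼ gamma_aug_chow R P^d
     & gamma_chow R P^d ≼ gamma_aug_chow R P^d]).
Proof.
have [dL [L [lam [EL unif mono]]]] := P_UMEL.
have [m rkP] : exists m, rank P = m.+2.
  by exists (rank P).-2; case: (rank P) P_rank => [|[]].
pose beta := descent_count lam.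
have flagP B : size B = m.+1 -> flag_count (T := P) B = subsum beta B.
  by move=> szB; apply: flag_count_descents; rewrite // szB rkP.
have flagT B : size B = m ->
    flag_count (T := trunc P) B = subsum (beta \o rcons^~ false) B.
  move=> szB; rewrite flag_count_trunc ?rkP // flagP ?size_rcons ?szB //.
  by rewrite subsum_rcons add0r.
have flagD B : size B = m.+1 -> flag_count (T := P^d) B = subsum (beta \o rev) B.
  by move=> szB; rewrite flag_count_dual ?szB ?rkP // flagP ?size_rev // subsum_rev.
have rkT : rank (trunc P) = m.+1 by rewrite rank_trunc // rkP.
have rkD : rank P^d = m.+2 by rewrite rank_dual.
have [cP aP] := chow_gamma_expansion R P_graded rkP flagP.
have [cT aT] := chow_gamma_expansion R (trunc_graded P_graded P_rank) rkT flagT.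
have [cD aD] := chow_gamma_expansion R (dual_graded P_graded) rkD flagD.
rewrite stable_sum_rev_false in cD; rewrite stable_sum_rev_true in aD.
have same n (f f' g : {poly R}) :
    gamma_expansion n f g -> gamma_expansion n f' g -> f = f'.
  by move=> [_ ->] [_ ->].
have chowD : chow R P^d = aug_chow R (trunc P) := same _ _ _ _ cD aT.
have augD : aug_chow R P^d = aug_chow R P := same _ _ _ _ aD aP.
have gchowD : gamma_chow R P^d = gamma_aug_chow R (trunc P).
  by rewrite /gamma_chow /gamma_aug_chow rkD rkT chowD.
have gaugD : gamma_aug_chow R P^d = gamma_aug_chow R P.
  by rewrite /gamma_aug_chow rkD rkP augD.
have gP : gamma_chow R P = stable_sum R false m.+1 beta.
  by rewrite /gamma_chow rkP; apply: gammaP.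
have gaP : gamma_aug_chow R P = stable_sum R true m.+1 beta.
  by rewrite /gamma_aug_chow rkP; apply: gammaP.
have gT : gamma_chow R (trunc P) = stable_sum R false m (beta \o rcons^~ false).
  by rewrite /gamma_chow rkT; apply: gammaP.
have gaT : gamma_aug_chow R (trunc P) = stable_sum R true m (beta \o rcons^~ false).
  by rewrite /gamma_aug_chow rkT; apply: gammaP.
(* There is exactly one maximal chain without descents. *)
have beta0 : beta (nseq m.+1 false) = 1%N.
  have := flagP (nseq m.+1 false); rewrite size_nseq => /(_ erefl).
  have -> F : subsum F (nseq m.+1 false) = F (nseq m.+1 false) :> nat.
    by elim: m.+1 F => //= n IHn F; rewrite IHn add0r.
  rewrite /flag_count mask_false /= => <-; rewrite lt_neqAle lex1 andbT.
  by rewrite -rk_lt_rank // rk_bot // rkP.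
have nz1 ok : ((stable_sum R ok m.+1 beta)`_0 != 0)%R.
  by rewrite coef0_stable_sum beta0 oner_neq0.
have nz2 ok : ((stable_sum R ok m (beta \o rcons^~ false))`_0 != 0)%R.
  rewrite coef0_stable_sum /= (_ : rcons _ _ = nseq m.+1 false) ?beta0 ?oner_neq0 //.
  by rewrite -[LHS]revK rev_rcons rev_nseq -[_ :: _]/(nseq m.+1 false) rev_nseq.
have betaE : beta =1 path_count (level_width lam) (level_rel lam) (fun=> 1%N).
  exact: descent_count_paths.
have sumE ok n (b b' : bitseq -> nat) :
    b =1 b' -> stable_sum R ok n b = stable_sum R ok n b'.
  by move=> bb'; apply: eq_stable_sum => S _.
have := @prec_stable_sums _ R _ (level_width lam) _ m (@level_rel_staircase _ _ _ _ lam).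
rewrite -!(sumE _ _ _ _ betaE).
rewrite -!(sumE _ _ (beta \o rcons^~ false) _ (fun S => betaE (rcons S false))).
case=> p1 p2 p3 p4.
have [h1 k1] := prec_interlaces cT cP (nz2 _) (nz1 _) p1.
have [h2 k2] := prec_interlaces cT aT (nz2 _) (nz2 _) p2.
have [h3 k3] := prec_interlaces cP aP (nz1 _) (nz1 _) p3.
have [h4 k4] := prec_interlaces aT aP (nz2 _) (nz1 _) p4.
by rewrite chowD augD gchowD gaugD gP gaP gT gaT; do 2!split; split.
Qed.
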